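(* Let $0<q<\infty$ and let $E$ be a quasi-Banach sequence lattice. Then the following conditions are equivalent: (a) $E$ has the $S_q$-property; (b) $E$ is a uniform $\mathcal{K}$-monotone space with respect to the couple $(\ell^0,\ell^q)$. Therefore, from condition (a) it follows that $E\in Int(\ell^0,\ell^q)$. In the case when $q\ge1$, the converse holds as well, i.e., $E$ has the $S_q$-property if and only if $E\in Int(\ell^0,\ell^q)$.
   Context: All sequences are real. $\|x\|_{\ell^q}=(\sum_k|x_k|^q)^{1/q}$; $\ell^0$ is the linear space of eventually zero sequences equipped with $\|x\|_{\ell^0}:=\mathrm{card}\{k:x_k\ne0\}$ (generating the discrete topology). For a bounded sequence $u$, $(u_k^* )$ is the nonincreasing rearrangement of $(|u_k|)$: $u_k^*:=\inf_{\mathrm{card}A=k-1}\sup_{i\in\mathbb{N}\setminus A}|u_i|$. A quasi-Banach sequence lattice is a quasi-Banach space $E$ of real sequences such that $|y_k|\le|x_k|$ for all $k$ and $(x_k)\in E$ imply $(y_k)\in E$ and $\|(y_k)\|_E\le\|(x_k)\|_E$. $S_q$-property: $E\ne\{0\}$, $E\subseteq\ell^q$, and there is a constant $C$ such that whenever $x\in E$ and $y\in\ell^q$ satisfy $\sum_{n=1}^\infty|x_n|^q=\sum_{n=1}^\infty|y_n|^q$ and $\sum_{n=1}^m(x_n^* )^q\le\sum_{n=1}^m(y_n^* )^q$ for all $m\in\mathbb{N}$, it follows that $y\in E$ and $\|y\|_E\le C\|x\|_E$. For $x\in\ell^q$, $t>0$, $\mathcal{K}(t,x;\ell^0,\ell^q):=\inf\{\|x_0\|_{\ell^0}+t\|x_1\|_{\ell^q}:x=x_0+x_1,\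 x_0\in\ell^0,\ x_1\in\ell^q\}$. $E$ is a uniform $\mathcal{K}$-monotone space with respect to $(\ell^0,\ell^q)$ if $\ell^0\subset E\subset\ell^q$ with continuous inclusions and there is a constant $C$ such that whenever $x\in E$, $y\in\ell^q$ satisfy $\mathcal{K}(t,y;\ell^0,\ell^q)\le\mathcal{K}(t,x;\ell^0,\ell^q)$ for all $t>0$, then $y\in E$ and $\|y\|_E\le C\|x\|_E$. $\mathfrak{L}(\ell^0,\ell^q)$ is the set of bounded linear operators $T$ on $\ell^q$ mapping $\ell^0$ into $\ell^0$ with $\sup_{x\in\ell^0,x\ne0}\|Tx\|_{\ell^0}/\|x\|_{\ell^0}<\infty$. $Int(\ell^0,\ell^q)$ is the class of all quasi-Banach spaces $E$ with continuous inclusions $\ell^0\subset E\subset\ell^q$ such that every $T\in\mathfrak{L}(\ell^0,\ell^q)$ maps $E$ boundedly into $E$. *)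

(* Defs.v *)
From HB Require Import structures.
From mathcomp Require Import all_boot all_order all_algebra finmap.
From mathcomp Require Import all_classical all_reals all_analysis.
Set Implicit Arguments.
Unset Strict Implicit.
Unset Printing Implicit Defensive.
Import Order.TTheory GRing.Theory Num.Theory numFieldNormedType.Exports.
Local Open Scope classical_set_scope.
Local Open Scope ring_scope.

(* A space of real sequences is given by its underlying set [E : set R^nat]
   together with a functional [N : R^nat -> R], whose values outside [E] are
   irrelevant.  Sequences are indexed from 0. *)

Definition quasi_norm (R : realType) (E : set R^nat) (N : R^nat -> R) : Prop :=
  [/\ forall x, E x -> 0 <= N x,
      forall x, E x -> N x = 0 -> x = 0,
      forall (a : R) x, E x -> N (a *: x) = `|a| * N x &
      exists C : R, forall x y, E x -> E y -> N (x + y) <= C * (N x + N y)].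

Definition quasi_complete (R : realType) (E : set R^nat) (N : R^nat -> R) :
    Prop :=
  forall u : nat -> R^nat, (forall n, E (u n)) ->
    (forall e : R, 0 < e -> exists n0 : nat, forall m n : nat,
      (n0 <= m)%N -> (n0 <= n)%N -> N (u m - u n) < e) ->
    exists2 x, E x & (N (u n - x) @[n --> \oo] --> (0 : R)).

Definition quasi_banach (R : realType) (E : set R^nat) (N : R^nat -> R) :
    Prop :=
  [/\ E 0, forall (a : R) x y, E x -> E y -> E (a *: x + y),
      quasi_norm E N & quasi_complete E N].

Definition quasi_banach_lattice (R : realType) (E : set R^nat)
    (N : R^nat -> R) : Prop :=
  quasi_banach E N /\
  forall x y : R^nat, E x -> (forall k, `|y k| <= `|x k|) ->
    E y /\ N y <= N x.

Definition supp (R : realType) (x : R^nat) : set nat := [set k | x k != 0].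

Definition l0 (R : realType) : set R^nat := [set x | finite_set (supp x)].

Definition l0norm (R : realType) (x : R^nat) : R := #|` fset_set (supp x)|%:R.

Definition qsum (R : realType) (q : R) (x : R^nat) : \bar R :=
  (\sum_(0 <= k <oo) (`|x k| `^ q)%:E)%E.

Definition lq (R : realType) (q : R) : set R^nat :=
  [set x | (qsum q x < +oo)%E].

Definition lqnorm (R : realType) (q : R) (x : R^nat) : R :=
  fine (qsum q x) `^ q^-1.

(* [rearr u k] is the (k+1)-st term $u_{k+1}^*$ in one-based indexing. *)
Definition rearr (R : realType) (u : R^nat) (k : nat) : R :=
  inf [set sup [set `|u i| | i in [set i | i \notin A]] |
       A in [set A : {fset nat} | #|` A| = k]].

Definition Sq_property (R : realType) (q : R) (E : set R^nat)
    (N : R^nat -> R) : Prop :=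
  [/\ E <> [set 0], E `<=` lq q &
      exists C : R, forall x y : R^nat, E x -> lq q y ->
        qsum q x = qsum q y ->
        (forall m : nat, \sum_(0 <= n < m) rearr x n `^ q
                         <= \sum_(0 <= n < m) rearr y n `^ q) ->
        E y /\ N y <= C * N x].

Definition Kfun (R : realType) (q t : R) (x : R^nat) : R :=
  inf [set r | exists x0 x1 : R^nat,
    [/\ l0 x0, lq q x1, x = x0 + x1 & r = l0norm x0 + t * lqnorm q x1]].

(* The sets $\{y : N_A(y - x) < d\}$ form a neighbourhood base at [x], also for
   a quasi-norm and for the cardinality functional on [l0]. *)
Definition continuous_inclusion (R : realType) (A : set R^nat)
    (NA : R^nat -> R) (B : set R^nat) (NB : R^nat -> R) : Prop :=
  A `<=` B /\
  forall x, A x -> forall e : R, 0 < e -> exists2 d : R, 0 < d &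
    forall y, A y -> NA (y - x) < d -> NB (y - x) < e.

Definition intermediate (R : realType) (q : R) (E : set R^nat)
    (N : R^nat -> R) : Prop :=
  continuous_inclusion (@l0 R) (@l0norm R) E N /\
  continuous_inclusion E N (lq q) (lqnorm q).

Definition uniform_K_monotone (R : realType) (q : R) (E : set R^nat)
    (N : R^nat -> R) : Prop :=
  intermediate q E N /\
  exists C : R, forall x y : R^nat, E x -> lq q y ->
    (forall t : R, 0 < t -> Kfun q t y <= Kfun q t x) ->
    E y /\ N y <= C * N x.

Definition maps_boundedly (R : realType) (T : R^nat -> R^nat)
    (E : set R^nat) (N : R^nat -> R) : Prop :=
  (forall x, E x -> E (T x)) /\
  exists C : R, forall x, E x -> N (T x) <= C * N x.

(* An operator on [lq q] is a function on all sequences of which only the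
   restriction to [lq q] matters. *)
Definition admissible_operator (R : realType) (q : R) (T : R^nat -> R^nat) :
    Prop :=
  [/\ forall (a : R) x y, lq q x -> lq q y -> T (a *: x + y) = a *: T x + T y,
      maps_boundedly T (lq q) (lqnorm q),
      forall x, l0 x -> l0 (T x) &
      has_ubound [set l0norm (T x) / l0norm x | x in [set x | l0 x /\ x <> 0]]].

Definition Int_l0_lq (R : realType) (q : R) (E : set R^nat)
    (N : R^nat -> R) : Prop :=
  [/\ quasi_banach E N, intermediate q E N &
      forall T, admissible_operator q T -> maps_boundedly T E N].

(* Main.v *)
Require Import Defs.
From mathcomp Require Import all_boot all_order all_algebra finmap.
From mathcomp Require Import all_classical all_reals all_analysis.
From mathcomp Require Import ring lra zify.
Import Order.TTheory GRing.Theory Num.Theory numFieldNormedType.Exports.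
Set Implicit Arguments.
Unset Strict Implicit.
Unset Printing Implicit Defensive.
Local Open Scope classical_set_scope.
Local Open Scope ring_scope.

(** Everything is expressed through the numbers err q x m, the m-th being the
    q-th power of the l^q-distance from x to the sequences with at most m
    nonzero terms.  Removing the m largest terms of x is optimal, so err q x m
    is the sum of the q-th powers of all other terms, that is, the total sum
    minus the first m terms of the sum of the x*_k ^ q (err_head_set, le_err).
    Hence the two hypotheses of the S_q-property say that err y 0 = err x 0
    and err y m <= err x m for all m.

    _Consequences of the S_q-property._  Domination of K-functionals gives only
    err y (2 n) <= 2^q err x n (err_le_of_Kfun), and an operator bounded on both
    ends of the couple gives err (T x) (M n) <= K^q err x n (admissible_err).
    Both are absorbed by dilation: if D x repeats each term of x exactly M
    times, then err (D x) m >= err x n for m < M (n + 1), so K D x dominates y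
    in the sense of all the err (Sq_err_dilation).  The sequence D x is a sum of
    M copies of x, moved injectively, and the S_q-property places each copy in E
    with a uniform bound.  The missing equality of the total sums is restored by
    enlarging y at its largest term, which changes err y 0 alone
    (Sq_majorized).  The inclusion of E in l^q is continuous because a sequence
    of elements of E with norms decreasing fast has a common majorant in E
    (lat_sup): otherwise this majorant would have infinite l^q-norm.

    _From K-monotonicity to S_q._  If err y m <= err x m for all m, then each
    decomposition of x is matched by one of y at no greater cost
    (Kfun_le_of_err).

    _From interpolation to S_q, for q >= 1._  Suppose err y m <= err x m for
    all m and let x, y be nonincreasing and nonnegative.  Where y_i <= x_i, a
    diagonal operator produces y_i from x_i.  Where y_i > x_i, place the numbers
    err x j and err y j on a line, so that the intervals between consecutive
    ones have lengths x_j^q and y_i^q; the upper half of the i-th interval of y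
    is covered by finitely many intervals of x, all with j >= i, hence all
    shorter than it.  Therefore no interval of x meets more than two of those
    chosen, and y_i is an average of the corresponding x_j, up to normalization.
    The result is a matrix with finite rows and at most three nonzero entries in
    each column that maps x to y (tail_cover, spread_of_err); convexity of the
    q-th power makes it bounded on l^q (spread_operator), with bounds not
    depending on x and y.  So y belongs to E.

    The constant is made uniform by a gliding hump (Int_spread_bounded): if it
    could not be, countably many bad pairs, scaled and moved to disjoint blocks
    of indices, would combine into one pair whose second member, although in E,
    has blocks of unbounded norm. *)

(** * Sums of q-th powers *)

Section Sums.
Context {R : realType} (q : R) (hq : 0 < q).
Implicit Types (x y u : R^nat) (A B : {fset nat}).

Definition off A x : R^nat := fun i => if i \in A then 0 else x i.

Lemma le_powRq (a b : R) : 0 <= a -> a <= b -> a `^ q <= b `^ q.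
Proof.
move=> a0 ab; have b0 := le_trans a0 ab.
by apply: ge0_ler_powR; rewrite ?nnegrE// ltW.
Qed.

Lemma le_powRV (a b : R) : 0 <= a -> a <= b -> a `^ q^-1 <= b `^ q^-1.
Proof.
move=> a0 ab; have b0 := le_trans a0 ab.
by apply: ge0_ler_powR; rewrite ?nnegrE// invr_ge0 ltW.
Qed.

Lemma powRKV (a : R) : 0 <= a -> (a `^ q) `^ q^-1 = a.
Proof. by move=> a0; rewrite -powRrM divff ?gt_eqF// powRr1. Qed.

Lemma powRVK (a : R) : 0 <= a -> (a `^ q^-1) `^ q = a.
Proof. by move=> a0; rewrite -powRrM mulVf ?gt_eqF// powRr1. Qed.

Lemma qterm_ge0 x i : (0 <= (`|x i| `^ q)%:E)%E.
Proof. by rewrite lee_fin powR_ge0. Qed.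

Lemma powR00 : (0 : R) `^ q = 0.
Proof. by rewrite powR0// gt_eqF. Qed.

Lemma qsum_ge0 x : (0 <= qsum q x)%E.
Proof. by apply: nneseries_ge0 => *; exact: qterm_ge0. Qed.

Lemma qsumE x : qsum q x = \esum_(i in [set: nat]) (`|x i| `^ q)%:E.
Proof. by apply: nneseries_esumT => i; exact: qterm_ge0. Qed.

Lemma le_qsum x y : (forall k, `|x k| <= `|y k|) -> (qsum q x <= qsum q y)%E.
Proof.
move=> xy; apply: lee_nneseries => [i _ _|i _]; first exact: qterm_ge0.
by rewrite lee_fin le_powRq.
Qed.

Lemma qsumZ (c : R) x : qsum q (c *: x) = ((`|c| `^ q)%:E * qsum q x)%E.
Proof.
rewrite /qsum -nneseriesZl; last by move=> *; exact: qterm_ge0.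
by apply: eq_eseriesr => i _; rewrite normrM powRM.
Qed.

Lemma lq_fin x : lq q x -> qsum q x = (fine (qsum q x))%:E.
Proof. by move=> lx; rewrite fineK// ge0_fin_numE// qsum_ge0. Qed.

Lemma le_lq x y : (forall k, `|x k| <= `|y k|) -> lq q y -> lq q x.
Proof. by move=> /le_qsum; exact: le_lt_trans. Qed.

Lemma le_fine_qsum x y : lq q y -> (qsum q x <= qsum q y)%E ->
  fine (qsum q x) <= fine (qsum q y).
Proof.
move=> ly xy; have lx : lq q x by exact: le_lt_trans ly.
by rewrite -lee_fin -!lq_fin.
Qed.

Lemma fine_qsum_ge0 x : 0 <= fine (qsum q x).
Proof. by rewrite fine_ge0 ?qsum_ge0. Qed.

Lemma le_lqnorm x y : (forall k, `|x k| <= `|y k|) -> lq q y ->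
  lqnorm q x <= lqnorm q y.
Proof.
by move=> xy ly; rewrite le_powRV ?fine_qsum_ge0// le_fine_qsum// le_qsum.
Qed.

Lemma lqnorm_ge0 x : 0 <= lqnorm q x.
Proof. exact: powR_ge0. Qed.

Lemma lqZ (c : R) x : lq q x -> lq q (c *: x).
Proof.
by move=> lx; rewrite /lq /= qsumZ (lq_fin lx) -EFinM ltry.
Qed.

Lemma lqnormZ (c : R) x : lq q x -> lqnorm q (c *: x) = `|c| * lqnorm q x.
Proof.
move=> lx; rewrite /lqnorm qsumZ (lq_fin lx) -EFinM /=.
by rewrite powRM ?powR_ge0 ?fine_qsum_ge0// powRKV.
Qed.

Lemma qsum_off A x :
  qsum q x = ((\sum_(i <- A) `|x i| `^ q)%:E + qsum q (off A x))%E.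
Proof.
rewrite !qsumE (esumID [set` A])//.
congr (_ + _)%E.
  rewrite setTI esum_fset//.
  by rewrite fsbig_finite ?set_fsetK ?sumEFin//; exact: finite_fset.
rewrite esum_mkcondr; apply: eq_esum => i _; rewrite in_setC /off.
rewrite (_ : (i \in [set` A]) = (i \in A)).
  by case: (i \in A); rewrite /= ?normr0 ?powR00.
by apply/idP/idP; rewrite inE.
Qed.

Lemma lq_off A x : lq q x -> lq q (off A x).
Proof.
by apply: le_lq => k; rewrite /off; case: ifP; rewrite ?normr0.
Qed.

Lemma fine_qsum_off A x : lq q x ->
  fine (qsum q x) = \sum_(i <- A) `|x i| `^ q + fine (qsum q (off A x)).
Proof.
move=> lx; apply: EFin_inj; rewrite EFinD -(lq_fin lx) -(lq_fin (lq_off A lx)).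
exact: qsum_off.
Qed.

Lemma qsum_fset_le A x : ((\sum_(i <- A) `|x i| `^ q)%:E <= qsum q x)%E.
Proof. by rewrite (qsum_off A x) leeDl ?qsum_ge0. Qed.

Lemma qsum_reindex (f : nat -> nat) x y : injective f ->
  (forall k, y (f k) = x k) -> (forall i, (forall k, f k <> i) -> y i = 0) ->
  qsum q y = qsum q x.
Proof.
move=> finj yf y0; rewrite !qsumE (esumID (range f))//.
rewrite setTI [X in (_ + X)%E]esum1 ?adde0; last first.
  move=> i [_ /= nfi]; rewrite y0 ?normr0 ?powR00// => k fk.
  by apply: nfi; exists k.
rewrite esum_image; last by move=> a b _ _; exact: finj.
by apply: eq_esum => i _; rewrite yf.
Qed.

(** The tails of a convergent series vanish; with the greedy order this makes
    err q x n tend to 0. *)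
Lemma qsum_tail_small x (e : R) : lq q x -> 0 < e ->
  exists n, fine (qsum q (off [fset i in iota 0 n]%fset x)) < e.
Proof.
move=> lx e0.
have := @nneseries_tail_cvg _ (fun k => (`|x k| `^ q)%:E) xpredT lx
  (fun k _ => qterm_ge0 x k).
move=> /(_ [set z | (z < e%:E)%E]) [].
  apply: open_nbhs_nbhs; split; last by rewrite /= lte_fin.
  exact: open_ereal_lt_ereal.
move=> n _ /(_ n) /= /(_ (leqnn _)) tn; exists n.
rewrite -lte_fin -(lq_fin (lq_off _ lx)).
have : qsum q x = ((\sum_(i <- [fset i in iota 0 n]%fset) `|x i| `^ q)%:E
    + \sum_(n <= k <oo) (`|x k| `^ q)%:E)%E.
  rewrite /qsum (@nneseries_split _ _ 0 n); last by move=> *; exact: qterm_ge0.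
  rewrite add0n sumEFin big_imfset//=.
  by rewrite undup_id ?iota_uniq// /index_iota subn0.
rewrite (qsum_off [fset i in iota 0 n]%fset) => eqS.
rewrite -(@lteD2lE _ (\sum_(i <- [fset i in iota 0 n]%fset) `|x i| `^ q)%:E)//.
by rewrite eqS lteD2lE.
Qed.

End Sums.

(** * Greedy order and best approximation by sparse sequences *)

Definition head_set (s : nat -> nat) (n : nat) : {fset nat} :=
  [fset s k | k in iota 0 n]%fset.

Lemma head_setP (s : nat -> nat) n i :
  reflect (exists2 k, (k < n)%N & i = s k) (i \in head_set s n).
Proof.
apply: (iffP idP) => [/imfsetP[k /= kn ->]|[k kn ->]].
  by exists k => //; move: kn; rewrite mem_iota.
by apply/imfsetP; exists k => //=; rewrite mem_iota.
Qed.

Lemma card_head_set (s : nat -> nat) n : injective s -> #|` head_set s n| = n.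
Proof.
move=> sinj; rewrite card_imfset//= undup_id ?iota_uniq// size_iota//.
Qed.

Lemma sum_head_set (R : nmodType) (s : nat -> nat) n (F : nat -> R) : injective s ->
  \sum_(i <- head_set s n) F i = \sum_(0 <= k < n) F (s k).
Proof.
move=> sinj; rewrite big_imfset/=; last by move=> a b _ _; exact: sinj.
by rewrite undup_id ?iota_uniq// /index_iota subn0.
Qed.

(** The pigeonhole principle behind all comparisons with the greedy order: a set
    of at most n indices misses one of the first n + 1 values. *)
Lemma exists_fresh (A : {fset nat}) (s : nat -> nat) n :
  injective s -> (#|` A| <= n)%N -> exists2 k, (k <= n)%N & s k \notin A.
Proof.
move=> sinj An; have /fsubsetPn[i /head_setP[k kn ->] niA] :
    ~~ (head_set s n.+1 `<=` A)%fset.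
  apply/negP => /fsubset_leq_card; rewrite card_head_set// => /leq_trans/(_ An).
  by rewrite ltnn.
by exists k.
Qed.

Section Greedy.
Context {R : realType} (q : R) (hq : 0 < q).
Implicit Types (x y u : R^nat) (A B : {fset nat}).

Lemma seq_max (I : eqType) (F : I -> R) (i0 : I) (s : seq I) : i0 \in s ->
  exists2 i, i \in s & forall j, j \in s -> F j <= F i.
Proof.
elim: s i0 => // a [|b s] IH i0 _.
  by exists a; rewrite ?mem_head// => j; rewrite inE => /eqP ->.
have [i is_ imax] := IH b (mem_head _ _).
have [Fai|Fia] := leP (F a) (F i).
  by exists i => [|j]; rewrite inE ?is_ ?orbT// => /orP[/eqP ->//|/imax].
exists a; rewrite ?mem_head// => j; rewrite inE => /orP[/eqP ->//|/imax Fj].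
exact: le_trans Fj (ltW Fia).
Qed.

Lemma lq_small x (e : R) : lq q x -> 0 < e ->
  exists n, forall i, (n <= i)%N -> `|x i| < e.
Proof.
move=> lx e0; have [n] := qsum_tail_small hq lx (powR_gt0 q e0).
set B := [fset i in iota 0 n]%fset => tn; exists n => i ni.
rewrite ltNge; apply/negP => ei.
have := le_powRq hq (ltW e0) ei; apply/negP; rewrite -ltNge.
apply: le_lt_trans tn; rewrite -lee_fin -(lq_fin (lq_off hq B lx)).
have := qsum_fset_le hq [fset i]%fset (off B x).
by rewrite big_seq_fset1 /off !inE mem_iota /= add0n ltnNge ni.
Qed.

(** Terms of an l^q sequence tend to 0, so only finitely many exceed a given
    nonzero one and the maximum is attained. *)
Lemma exists_max_off A x : lq q x ->
  exists2 i, i \notin A & forall j, j \notin A -> `|x j| <= `|x i|.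
Proof.
move=> lx.
have [i0 _ i0A] := @exists_fresh A id _ (@inj_id _) (leqnn _).
have [[j0 [j0A xj0]]|nex] := pselect (exists j, j \notin A /\ 0 < `|x j|);
  last first.
  exists i0 => // j jA; rewrite (le_trans _ (normr_ge0 _))// leNgt.
  by apply/negP => xj; apply: nex; exists j.
have [n xn] := lq_small lx xj0.
have j0n : (j0 < n)%N.
  by rewrite ltnNge; apply/negP => /xn; rewrite ltxx.
have j0s : j0 \in [seq i <- iota 0 n | i \notin A].
  by rewrite mem_filter j0A mem_iota.
have [i] := seq_max (fun i => `|x i|) j0s.
rewrite mem_filter => /andP[iA _] imax; exists i => // j jA.
have [jn|nj] := ltnP j n.
  by apply: imax; rewrite mem_filter jA mem_iota.
exact: le_trans (ltW (xn _ nj)) (imax _ j0s).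
Qed.

(** An enumeration of indices that lists the terms by nonincreasing modulus: each
    term is the largest among those not yet listed.  Indices of zero terms may be
    left out, but no others (greedy_support). *)
Definition greedy x (s : nat -> nat) : Prop := injective s /\
  forall n j, (forall k, (k < n)%N -> s k <> j) -> `|x j| <= `|x (s n)|.

(** Choose repeatedly an index of a largest term outside the finite set of the
    indices already chosen. *)
Lemma exists_greedy x : lq q x -> exists s, greedy x s.
Proof.
move=> lx; have /choice[f fP] : forall A : {fset nat}, exists i,
    i \notin A /\ forall j, j \notin A -> `|x j| <= `|x i|.
  by move=> A; have [i iA imax] := exists_max_off A lx; exists i.
pose t n := iter n (fun A : {fset nat} => (f A |` A)%fset) fset0.
have tE n i : i \in t n -> exists2 k, (k < n)%N & i = f (t k).
  elim: n => [|n IH]; first by rewrite in_fset0.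
  rewrite /t iterS in_fset1U => /orP[/eqP ->|/IH[k kn ->]].
    by exists n.
  by exists k => //; exact: ltnW.
have tI n k : (k < n)%N -> f (t k) \in t n.
  elim: n => // n IH; rewrite ltnS leq_eqVlt => /orP[/eqP ->|/IH fk].
    by rewrite /t iterS fset1U1.
  by rewrite /t iterS in_fset1U fk orbT.
exists (f \o t); split=> [k l /= fkl|n j nj /=].
  have [kl|lk|//] := ltngtP k l.
    by have := (fP (t l)).1; rewrite -fkl tI.
  by have := (fP (t k)).1; rewrite fkl tI.
by apply: (fP _).2; apply/negP => /tE[k kn jE]; exact: (nj k kn).
Qed.

Lemma greedy_nonincr x s : greedy x s ->
  forall m n, (m <= n)%N -> `|x (s n)| <= `|x (s m)|.
Proof.
move=> [sinj sP] m n mn; apply: sP => k km /sinj kn.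
by move: mn; rewrite -kn leqNgt km.
Qed.

(** A set of n indices misses some s k with k <= n, so the supremum off this set
    is at least the modulus of x at s n; the set of s k with k < n attains it. *)
Lemma rearrE x s : greedy x s -> forall n, rearr x n = `|x (s n)|.
Proof.
move=> gs n; have [sinj sP] := gs.
have ubA (A : {fset nat}) :
    ubound [set `|x i| | i in [set i | i \notin A]] `|x (s 0%N)|.
  by move=> _ [i _ <-]; apply: sP.
have lbA : lbound [set sup [set `|x i| | i in [set i | i \notin A]]
    | A in [set A : {fset nat} | #|` A| = n]] `|x (s n)|.
  move=> _ [A /= An <-].
  have [k kn kA] : exists2 k, (k <= n)%N & s k \notin A.
    by apply: exists_fresh => //; rewrite An.
  apply: le_trans (greedy_nonincr gs kn) _.
  by apply: ub_le_sup; [exists `|x (s 0%N)|; exact: ubA|exists (s k)].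
apply/eqP; rewrite eq_le; apply/andP; split; last first.
  apply: lb_le_inf => //; eexists; exists (head_set s n) => //=.
  exact: card_head_set.
apply: (@le_trans _ _ (sup [set `|x i| | i in [set i | i \notin head_set s n]])).
  apply: ge_inf; first by exists `|x (s n)|.
  by exists (head_set s n) => //=; exact: card_head_set.
apply: ge_sup.
  exists `|x (s n)|, (s n) => //=; apply/head_setP => -[k kn /sinj nk].
  by rewrite nk ltnn in kn.
move=> _ [i /= iA <-]; apply: sP => k kn ski.
by move/negP: iA; apply; apply/head_setP; exists k.
Qed.

Lemma greedy_support x s : lq q x -> greedy x s ->
  forall k, (forall n, s n <> k) -> x k = 0.
Proof.
move=> lx [sinj sP] k nk; apply/eqP; rewrite -normr_le0 leNgt.
apply/negP => /(lq_small lx)[n xn].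
have [m _ mA] : exists2 m, (m <= n)%N & s m \notin [fset i in iota 0 n]%fset.
  apply: exists_fresh => //.
  by rewrite card_imfset//= undup_id ?iota_uniq// size_iota.
have /xn : (n <= s m)%N by move: mA; rewrite !inE mem_iota /= -leqNgt.
by apply/negP; rewrite -leNgt; apply: sP => l _; exact: nk.
Qed.

(** The q-th power of the error of the best approximation of x in l^q by a
    sequence with at most m nonzero terms. *)
Definition err x (m : nat) : R :=
  fine (qsum q x) - \sum_(0 <= n < m) rearr x n `^ q.

Lemma err0 x : err x 0 = fine (qsum q x).
Proof. by rewrite /err big_geq// subr0. Qed.

Lemma errS x m : err x m - err x m.+1 = rearr x m `^ q.
Proof. by rewrite /err big_nat_recr//=; ring. Qed.

Lemma err_head_set x s m : lq q x -> greedy x s ->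
  err x m = fine (qsum q (off (head_set s m) x)).
Proof.
move=> lx gs; rewrite /err (fine_qsum_off hq (head_set s m) lx).
rewrite sum_head_set; last by case: gs.
rewrite (eq_bigr (fun n => rearr x n `^ q)) => [|i _]; first by ring.
by rewrite (rearrE gs).
Qed.

Lemma err_ge0 x m : lq q x -> 0 <= err x m.
Proof.
move=> lx; have [s gs] := exists_greedy lx.
by rewrite (err_head_set m lx gs) fine_qsum_ge0.
Qed.

Lemma err_nonincr x m n : lq q x -> (m <= n)%N -> err x n <= err x m.
Proof.
move=> lx; elim: n => [|n IH]; first by rewrite leqn0 => /eqP ->.
rewrite leq_eqVlt => /orP[/eqP ->//|]; rewrite ltnS => /IH; apply: le_trans.
by rewrite -subr_ge0 errS powR_ge0.
Qed.

(** Removing m terms other than the greedy ones removes no greater sum.  Induction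
    on m: a set outside the first m greedy indices has an element whose term is at
    most the (m + 1)-st greedy one. *)
Lemma le_err x A m : lq q x -> (#|` A| <= m)%N ->
  err x m <= fine (qsum q (off A x)).
Proof.
move=> lx Am; have [s gs] := exists_greedy lx; have [sinj sP] := gs.
suff : \sum_(i <- A) `|x i| `^ q <= \sum_(0 <= n < m) rearr x n `^ q.
  by rewrite /err (fine_qsum_off hq A lx); lra.
elim: m A Am => [|m IH] A Am.
  move: Am; rewrite leqn0 cardfs_eq0 => /eqP ->.
  by rewrite big_seq_fset0 big_geq.
have [Asub|/fsubsetPn[i iA ins]] := boolP (A `<=` head_set s m)%fset.
  apply: le_trans (_ : \sum_(0 <= n < m) rearr x n `^ q <= _).
    apply: IH; rewrite (leq_trans (fsubset_leq_card Asub))// card_head_set//.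
  by rewrite big_nat_recr//= lerDl powR_ge0.
rewrite (big_fsetD1 i)//= big_nat_recr//= addrC lerD//.
  by apply: IH; move: Am; rewrite (cardfsD1 i) iA.
rewrite (rearrE gs) le_powRq//; apply: sP => k km ski.
by move/negP: ins; apply; apply/head_setP; exists k.
Qed.

Lemma err_small x (e : R) : lq q x -> 0 < e -> exists n, err x n < e.
Proof.
move=> lx /(qsum_tail_small hq lx)[n tn]; exists n; apply: le_lt_trans tn.
by apply: le_err => //; rewrite card_imfset//= undup_id ?iota_uniq// size_iota.
Qed.

End Greedy.

(** * The K-functional *)

Section Pointwise.
Context {R : realType}.
Implicit Types x y : R^nat.

Lemma seq_addE x y i : (x + y) i = x i + y i. Proof. by []. Qed.
Lemma seq_subE x y i : (x - y) i = x i - y i. Proof. by []. Qed.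
Lemma seq_scaleE (a : R) x i : (a *: x) i = a * x i. Proof. by []. Qed.

End Pointwise.

Section Kfunctional.
Context {R : realType} (q : R) (hq : 0 < q).
Implicit Types (x y u : R^nat) (A B : {fset nat}).

(** Passing from l^q-norms to sums of q-th powers. *)
Lemma le_powRV_scale (a b c : R) : 0 <= a -> 0 <= b -> 0 <= c ->
  a `^ q^-1 <= c * b `^ q^-1 -> a <= c `^ q * b.
Proof.
move=> a0 b0 c0 /(le_powRq hq (powR_ge0 _ _)).
by rewrite (powRM _ c0 (powR_ge0 _ _)) (powRVK hq a0) (powRVK hq b0).
Qed.

Definition on A x : R^nat := fun i => if i \in A then x i else 0.

Lemma on_off A x : x = on A x + off A x.
Proof.
apply/funext => i; rewrite seq_addE /on /off.
by case: ifP => _; rewrite ?addr0 ?add0r.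
Qed.

Lemma supp_sub_l0 A u : (forall i, i \notin A -> u i = 0) -> 
  l0 u /\ l0norm u <= #|` A|%:R.
Proof.
move=> uA; have sub : supp u `<=` [set` A].
  by move=> i /= ui; apply/negPn/negP => /uA/eqP; rewrite (negbTE ui).
have fu : l0 u by exact: sub_finite_set sub (finite_fset _).
split=> //; rewrite /l0norm ler_nat fsubset_leq_card//.
by apply/fsubsetP => i; rewrite in_fset_set// inE => /sub.
Qed.

Lemma l0_on A x : l0 (on A x).
Proof. by apply: (supp_sub_l0 (A := A) _).1 => i iA; rewrite /on (negbTE iA). Qed.

Lemma l0norm_on A x : l0norm (on A x) <= #|` A|%:R.
Proof. by apply: (supp_sub_l0 _).2 => i iA; rewrite /on (negbTE iA). Qed.

Lemma l0norm_ge0 x : 0 <= l0norm x.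
Proof. exact: ler0n. Qed.

Lemma off_supp_le x x0 x1 : l0 x0 -> x = x0 + x1 ->
  forall i, `|off (fset_set (supp x0)) x i| <= `|x1 i|.
Proof.
move=> l x01 i; rewrite /off in_fset_set//.
case: ifPn => [_|]; first by rewrite normr0.
rewrite notin_setE /= => /negP; rewrite negbK => /eqP x0i.
by rewrite x01 seq_addE x0i add0r.
Qed.

(** The part x1 of a decomposition carries all terms of x off the support of
    x0. *)
Lemma err_le_split x x0 x1 m : lq q x -> l0 x0 -> lq q x1 -> x = x0 + x1 ->
  l0norm x0 <= m%:R -> err q x m <= fine (qsum q x1).
Proof.
move=> lx lx0 lx1 xE; rewrite ler_nat => x0m.
apply: le_trans (le_err hq lx x0m) _.
by apply: le_fine_qsum => //; apply: le_qsum => // i; exact: off_supp_le xE i.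
Qed.

Lemma Kfun_le t x x0 x1 : 0 < t -> l0 x0 -> lq q x1 -> x = x0 + x1 ->
  Kfun q t x <= l0norm x0 + t * lqnorm q x1.
Proof.
move=> t0 l0x lqx xE; apply: ge_inf; last by exists x0, x1.
exists 0 => _ [y0 [y1 [_ _ _ ->]]].
by rewrite addr_ge0 ?l0norm_ge0// mulr_ge0 ?lqnorm_ge0// ltW.
Qed.

Lemma l00 : l0 (0 : R^nat).
Proof. by apply: (supp_sub_l0 (A := fset0) _).1. Qed.

Lemma Kfun_split_nonempty t x : lq q x ->
  [set r | exists x0 x1 : R^nat,
    [/\ l0 x0, lq q x1, x = x0 + x1 & r = l0norm x0 + t * lqnorm q x1]] !=set0.
Proof. by move=> lx; eexists; exists 0, x; split; rewrite ?add0r//; exact: l00. Qed.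

(** For e above the n-term error of x (in norm) and t = (n + 1) / e, the greedy
    decomposition of x costs less than 2 n + 1.  So y has a decomposition of cost
    less than 2 n + 1: its sparse part has at most 2 n terms and its remainder
    has norm less than (2 n + 1) / t <= 2 e. *)
Lemma err_le_of_Kfun x y : lq q x -> lq q y ->
  (forall t, 0 < t -> Kfun q t y <= Kfun q t x) ->
  forall n, err q y (2 * n) <= 2 `^ q * err q x n.
Proof.
move=> lx ly Kyx n.
have ex0 := err_ge0 hq n lx; have ey0 := err_ge0 hq (2 * n) ly.
suff H : err q y (2 * n) `^ q^-1 <= 2 * err q x n `^ q^-1.
  exact: le_powRV_scale.
rewrite -ler_pdivrMl//; apply/ler_addgt0Pr => d d0.
set e := err q x n `^ q^-1 + d.
have e0 : 0 < e by rewrite ltr_wpDl ?powR_ge0.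
(* With this t the value t * e is n + 1, for n = 0 too. *)
pose t := n.+1%:R / e; have t0 : 0 < t by rewrite divr_gt0.
have Kx : Kfun q t x < (2 * n).+1%:R.
  have [s gs] := exists_greedy hq lx; have [sinj _] := gs.
  have lo := lq_off hq (head_set s n) lx.
  apply: le_lt_trans (Kfun_le t0 (l0_on _ _) lo (on_off _ _)) _.
  have := l0norm_on (head_set s n) x; rewrite card_head_set// => on_n.
  rewrite /lqnorm -(err_head_set hq _ lx gs).
  apply: (@lt_le_trans _ _ (n%:R + t * e)).
    by rewrite ler_ltD// ltr_pM2l// /e ltrDl.
  rewrite /t divfK ?gt_eqF// -natrD ler_nat; lia.
have [_ [y0 [y1 [l0y lqy yE ->]]] Ky] :=
  inf_lt (Kfun_split_nonempty t ly) (le_lt_trans (Kyx _ t0) Kx).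
have tl0 : 0 <= t * lqnorm q y1 by rewrite mulr_ge0 ?lqnorm_ge0// ltW.
have y0n : l0norm y0 <= (2 * n)%:R.
  by rewrite /l0norm ler_nat -ltnS -(ltr_nat R); apply: le_lt_trans Ky; rewrite lerDl.
have := err_le_split ly l0y lqy yE y0n => /(le_powRV hq ey0) H.
rewrite ler_pdivrMl//; apply: le_trans H _; rewrite -/(lqnorm q y1).
have : t * lqnorm q y1 < (2 * n).+1%:R.
  by apply: le_lt_trans Ky; rewrite lerDr l0norm_ge0.
rewrite -ltr_pdivlMl// => /ltW/le_trans; apply.
rewrite /t invf_div mulrAC ler_pdivrMr// (mulrC e) mulrAC ler_pM2r//.
rewrite -natrM ler_nat; lia.
Qed.

(** A decomposition of x with m terms in the sparse part leaves at least err x m,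
    and the greedy decomposition of y with m terms leaves only err y m. *)
Lemma Kfun_le_of_err x y : lq q x -> lq q y ->
  (forall m, err q y m <= err q x m) ->
  forall t, 0 < t -> Kfun q t y <= Kfun q t x.
Proof.
move=> lx ly eyx t t0; apply: lb_le_inf; first exact: Kfun_split_nonempty.
move=> _ [x0 [x1 [l0x lqx xE ->]]].
set m := #|` fset_set (supp x0)|.
have [s gs] := exists_greedy hq ly; have [sinj _] := gs.
apply: le_trans (Kfun_le t0 (l0_on _ _) (lq_off hq (head_set s m) ly) (on_off _ _)) _.
apply: lerD.
  by apply: le_trans (l0norm_on _ _) _; rewrite card_head_set.
rewrite (ler_pM2l t0); apply: (le_powRV hq); first exact: fine_qsum_ge0.
rewrite -(err_head_set hq m ly gs).
apply: le_trans (eyx m) _.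
exact: err_le_split lx l0x lqx xE (lexx _).
Qed.

End Kfunctional.

(** * Series and inclusions in a quasi-Banach lattice *)

Section Lattice.
Context {R : realType} (E : set R^nat) (N : R^nat -> R).
Hypothesis hE : quasi_banach_lattice E N.
Implicit Types (x y : R^nat) (z : nat -> R^nat).

Lemma lat_E0 : E 0. Proof. by case: hE => -[]. Qed.

Lemma lat_le x y : E x -> (forall k, `|y k| <= `|x k|) -> E y /\ N y <= N x.
Proof. by case: hE => _; apply. Qed.

Lemma lat_EZ a x : E x -> E (a *: x).
Proof.
by move=> Ex; have [_ /(_ a x 0 Ex lat_E0)] := hE.1; rewrite addr0.
Qed.

Lemma lat_ED x y : E x -> E y -> E (x + y).
Proof.
by move=> Ex Ey; have [_ /(_ 1 x y Ex Ey)] := hE.1; rewrite scale1r.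
Qed.

Lemma lat_NZ a x : E x -> N (a *: x) = `|a| * N x.
Proof. by move=> Ex; have [_ _ [_ _ NZ _] _] := hE.1; exact: NZ. Qed.

Lemma lat_N_ge0 x : E x -> 0 <= N x.
Proof. by have [_ _ [N0 _ _ _] _] := hE.1; exact: N0. Qed.

Lemma lat_N_eq0 x : E x -> N x = 0 -> x = 0.
Proof. by have [_ _ [_ N0 _ _] _] := hE.1; exact: N0. Qed.

Lemma lat_N_gt0 x : E x -> x <> 0 -> 0 < N x.
Proof.
move=> Ex x0; rewrite lt_neqAle lat_N_ge0// andbT eq_sym.
by apply/eqP => /(lat_N_eq0 Ex).
Qed.

Lemma lat_N0 : N 0 = 0.
Proof. by rewrite -(scale0r (0 : R^nat)) lat_NZ ?normr0 ?mul0r//; exact: lat_E0. Qed.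

(** A constant at least 1 may be iterated without case distinctions. *)
Lemma lat_quasi : exists2 C : R, 1 <= C &
  forall x y, E x -> E y -> N (x + y) <= C * (N x + N y).
Proof.
have [_ _ [_ _ _ [C hC]] _] := hE.1; exists (Num.max C 1).
  by rewrite le_max lexx orbT.
move=> x y Ex Ey; apply: le_trans (hC _ _ Ex Ey) _.
by rewrite ler_wpM2r ?addr_ge0 ?lat_N_ge0// le_max lexx.
Qed.

Definition partial (z : nat -> R^nat) (n p : nat) : R^nat :=
  fun i => \sum_(n <= k < p) `|z k i|.

(** The bounds (2 C)^-(k + 1) are those for which the quasi-triangle inequality
    with constant C reproduces itself in an induction on the number of terms. *)
Lemma lat_partial : exists2 C : R, 1 <= C & forall z,
  (forall k, E (z k) /\ N (z k) <= (2 * C) ^- k.+1) ->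
  forall p n, E (partial z n (n + p)) /\ N (partial z n (n + p)) <= (2 * C) ^- n.
Proof.
have [C C1 hC] := lat_quasi; exists C => // z zP.
have C0 : 0 < C by exact: lt_le_trans C1.
elim=> [|p IH] n.
  rewrite (_ : partial _ _ _ = 0); last first.
    by apply/funext => i; rewrite /partial addn0 big_geq.
  by split; [exact: lat_E0|rewrite lat_N0 invr_ge0 exprn_ge0// mulr_ge0// ltW].
pose a : R^nat := fun i => `|z n i|.
have [Ea Na] : E a /\ N a <= N (z n).
  by apply: lat_le => [|k]; [exact: (zP n).1|rewrite /a normr_id].
have [Er Nr] := IH n.+1.
have -> : partial z n (n + p.+1) = a + partial z n.+1 (n.+1 + p).
  apply/funext => i; rewrite seq_addE /partial.
  by rewrite addnS -addSn big_ltn// addSn ltnS leq_addr.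
split; first exact: lat_ED.
apply: le_trans (hC _ _ Ea Er) _.
apply: (@le_trans _ _ (C * ((2 * C) ^- n.+1 + (2 * C) ^- n.+1))).
  by rewrite ler_pM2l// lerD// (le_trans Na)//; case: (zP n).
have b0 : 0 < (2 * C) ^+ n by rewrite exprn_gt0// mulr_gt0.
rewrite exprSr; set b := (2 * C) ^+ n in b0 *.
by rewrite le_eqVlt; apply/orP; left; apply/eqP; field; rewrite !gt_eqF.
Qed.

(** The series of the moduli converges by completeness.  Convergence in E implies
    coordinatewise convergence, since by the lattice property |x_i| N(e_i) <= N(x) for
    the i-th unit vector e_i, which is in E as soon as some z_k has a nonzero
    i-th term.  So the sum majorizes each z_k. *)
Lemma lat_sup : exists c : nat -> R, (forall k, 0 < c k) /\ forall z,
  (forall k, E (z k) /\ N (z k) <= c k) ->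
  exists2 X, E X & forall k i, `|z k i| <= `|X i|.
Proof.
have [C C1 hC] := lat_partial; have C0 : 0 < C by exact: lt_le_trans C1.
exists (fun k => (2 * C) ^- k.+1); split=> [k|z zP].
  by rewrite invr_gt0 exprn_gt0// mulr_gt0.
pose s n := partial z 0 n.
have Es n : E (s n) by have := (hC z zP n 0%N).1.
have sB m n i : (m <= n)%N -> (s n - s m) i = partial z m n i.
  move=> mn; rewrite seq_subE /s /partial.
  by rewrite [X in X + _](big_cat_nat (n := m))//= addrAC subrr add0r.
have Nle m n : (m <= n)%N -> N (s n - s m) <= (2 * C) ^- m /\
    N (s m - s n) <= (2 * C) ^- m.
  move=> mn; have [Ep Np] := hC z zP (n - m)%N m.
  rewrite subnKC// in Ep Np.
  have [] : E (s n - s m) /\ N (s n - s m) <= N (partial z m n).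
    by apply: lat_le => // k; rewrite sB.
  move=> _ N1; have [] : E (s m - s n) /\ N (s m - s n) <= N (partial z m n).
    by apply: lat_le => // k; rewrite -(sB m n)// !seq_subE distrC.
  by move=> _ N2; split; [exact: le_trans N1 Np|exact: le_trans N2 Np].
have [_ _ _ cpl] := hE.1.
have [e e0|X EX Xlim] := cpl s Es.
  have [n0 n0e] : exists n0, (2 * C) ^- n0 < e.
    have : (geometric 1 ((2 * C)^-1) : R^nat) @ \oo --> (0 : R).
      apply: cvg_geometric; rewrite ger0_norm ?invr_ge0 ?mulr_ge0 ?ltW//.
      by rewrite invf_lt1 ?mulr_gt0//; lra.
    move=> /cvgr0Pnorm_lt /(_ _ e0)[n0 _ /(_ n0 (leqnn _))] /=.
    rewrite mul1r ger0_norm ?exprn_ge0 ?invr_ge0 ?mulr_ge0 ?ltW// exprVn => h.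
    by exists n0.
  have mono m : (n0 <= m)%N -> (2 * C) ^- m < e.
    move=> nm; apply: le_lt_trans n0e.
    by rewrite lef_pV2 ?posrE ?exprn_gt0 ?mulr_gt0// ler_weXn2l//; lra.
  exists n0 => m n mn nn; have [mn'|/ltnW nm'] := leqP m n.
    by apply: le_lt_trans (Nle _ _ mn').2 _; exact: mono.
  by apply: le_lt_trans (Nle _ _ nm').1 _; exact: mono.
exists X => // k i; rewrite leNgt; apply/negP => Xz.
pose d := `|z k i| - `|X i|; have d0 : 0 < d by rewrite subr_gt0.
pose e : R^nat := fun j => if j == i then 1 else 0.
have zi0 : 0 < `|z k i| by exact: le_lt_trans Xz.
have Ee : E e.
  have Ez := lat_EZ (`|z k i|^-1) (zP k).1.
  have [] // : E e /\ N e <= N (`|z k i|^-1 *: z k).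
  apply: lat_le => // j; rewrite /e; case: eqP => [->|_]; last by rewrite normr0.
  rewrite seq_scaleE normrM normr1 normfV normr_id.
  by rewrite mulVf// gt_eqF.
have Ne : 0 < N e.
  apply: lat_N_gt0 => // /(congr1 (fun f => f i)); rewrite /e eqxx.
  by move/eqP; rewrite oner_eq0.
(* The i-th coordinate alone keeps the partial sums away from X. *)
have low n : (k < n)%N -> d * N e <= N (s n - X).
  move=> kn; rewrite -(ger0_norm (ltW d0)) -lat_NZ//.
  have EsX : E (s n - X).
    by apply: lat_ED => //; rewrite -scaleN1r; exact: lat_EZ.
  have [] // : E (d *: e) /\ N (d *: e) <= N (s n - X).
  apply: lat_le => // j; rewrite seq_scaleE /e.
  case: eqP => [->|_]; last by rewrite mulr0 normr0.
  rewrite mulr1 (ger0_norm (ltW d0)) seq_subE.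
  have zs : `|z k i| <= s n i.
    rewrite /s /partial (bigD1_seq k)//= ?iota_uniq ?mem_index_iota//.
    by rewrite lerDl sumr_ge0.
  rewrite /d; apply: le_trans _ (ler_norm _); rewrite lerB//.
  exact: ler_norm.
have := Xlim; move=> /cvgr0Pnorm_lt /(_ _ (mulr_gt0 d0 Ne))[n0 _ Hn].
have /Hn /= : (n0 <= maxn n0 k.+1)%N by exact: leq_maxl.
have := low (maxn n0 k.+1); rewrite leq_maxr => /(_ isT) h1 h2.
have := le_lt_trans h1 (le_lt_trans (ler_norm _) h2).
by rewrite ltxx.
Qed.

(** If no bound existed, elements of fast decreasing norm in E and l^q-norms at
    least k + 1 would have a common majorant in E, hence in l^q. *)
Lemma lat_incl q : 0 < q -> E `<=` lq q ->
  exists2 K, 0 < K & forall x, E x -> lqnorm q x <= K * N x.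
Proof.
move=> hq Elq; apply: contrapT => nK.
have [c [c0 cP]] := lat_sup.
have /choice[x xP] : forall k : nat, exists x,
    E x /\ k.+1%:R / c k * N x < lqnorm q x.
  move=> k; apply: contrapT => nx; apply: nK.
  exists (k.+1%:R / c k) => [|x Ex]; first by rewrite divr_gt0.
  by rewrite leNgt; apply/negP => h; apply: nx; exists x.
have Nx k : 0 < N (x k).
  have [Ex lx] := xP k; rewrite lt_neqAle lat_N_ge0// andbT eq_sym.
  apply/eqP => Nx0; move: lx; rewrite Nx0 mulr0 (lat_N_eq0 Ex Nx0).
  rewrite -(scale0r (0 : R^nat)) lqnormZ ?normr0 ?mul0r ?ltxx//.
  exact/Elq/lat_E0.
pose z k := (c k / N (x k)) *: x k.
have Ez k : E (z k) by apply: lat_EZ; exact: (xP k).1.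
have [k|X EX Xz] := cP z.
  split=> //; rewrite lat_NZ; last exact: (xP k).1.
  by rewrite ger0_norm ?divfK ?gt_eqF// divr_ge0 ?ltW.
have big k : k.+1%:R <= lqnorm q X.
  apply: le_trans (le_lqnorm hq (Xz k) (Elq _ EX)).
  rewrite lqnormZ//; last exact/Elq/(xP k).1.
  rewrite (ger0_norm (divr_ge0 (ltW (c0 k)) (ltW (Nx k)))).
  have [_ /ltW] := xP k; rewrite mulrAC ler_pdivrMr// => h.
  by rewrite mulrAC ler_pdivlMr// mulrC (mulrC (c k)) (mulrC (N _)).
have := big (Num.truncn (lqnorm q X)); apply/negP; rewrite -ltNge.
exact: truncnS_gt.
Qed.

End Lattice.

(** * Copies and dilations *)

Section Copies.
Context {R : realType} (q : R) (hq : 0 < q).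
Implicit Types (x y u : R^nat) (A B : {fset nat}).

Lemma off_scale (c : R) A x : off A (c *: x) = c *: off A x.
Proof. by apply/funext => i; rewrite seq_scaleE /off; case: ifP; rewrite ?mulr0. Qed.

Lemma err_scale (c : R) x m : lq q x ->
  `|c| `^ q * err q x m <= err q (c *: x) m.
Proof.
move=> lx; have lcx := lqZ c lx.
have [s gs] := exists_greedy hq lcx; have [sinj _] := gs.
rewrite (err_head_set hq m lcx gs) off_scale qsumZ.
rewrite (lq_fin (lq_off hq (head_set s m) lx)) -EFinM /=.
apply: ler_wpM2l; first exact: powR_ge0.
by apply: le_err => //; rewrite card_head_set.
Qed.

(** The sequence y is x moved along f; the values of y off the range of f are
    zero. *)
Definition copy_of (f : nat -> nat) x y : Prop :=
  (forall k, y (f k) = x k) /\ (forall i, (forall k, f k <> i) -> y i = 0).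

(** The greedy indices of x, moved along f, are a candidate for y. *)
Lemma copy_err (f : nat -> nat) x y m : injective f -> copy_of f x y ->
  lq q x -> err q y m <= err q x m.
Proof.
move=> finj [yf y0] lx.
have ly : lq q y by rewrite /lq /= (qsum_reindex hq finj yf y0).
have [s gs] := exists_greedy hq lx; have [sinj _] := gs.
rewrite (err_head_set hq m lx gs).
have inj_fs : injective (f \o s) by exact: inj_comp.
have <- : qsum q (off (head_set (f \o s) m) y) = qsum q (off (head_set s m) x).
  apply: (qsum_reindex hq finj) => [k|i fi].
    rewrite /off yf; congr (if _ then _ else _).
    apply/head_setP/head_setP => -[l lm].
      by move=> /finj ->; exists l.
    by move=> ->; exists l.
  by rewrite /off y0// if_same.
by apply: le_err => //; rewrite card_head_set.
Qed.

Definition dilate (M : nat) x : R^nat := fun k => x (k %/ M.+1)%N.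

(** The terms of the dilation at the indices congruent to p, one of M + 1
    disjoint copies of x that add up to it. *)
Definition residue_part (M p : nat) x : R^nat :=
  fun k => if (k %% M.+1 == p)%N then x (k %/ M.+1)%N else 0.

Lemma residue_part_copy M p x : (p < M.+1)%N ->
  injective (fun k => k * M.+1 + p)%N /\
  copy_of (fun k => k * M.+1 + p)%N x (residue_part M p x).
Proof.
move=> pM; split=> [a b /addIn|]; first by move/eqP; rewrite eqn_pmul2r// => /eqP.
split=> [k|i ni]; rewrite /residue_part.
  by rewrite modnMDl modn_small// eqxx divnMDl// divn_small// addn0.
by case: eqP => // ip; case: (ni (i %/ M.+1)%N); rewrite -ip -divn_eq.
Qed.

Lemma pigeonhole_residue M n B : (#|` B| < M.+1 * n.+1)%N ->
  exists2 p, (p < M.+1)%N & (count (fun i => i %% M.+1 == p)%N B <= n)%N.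
Proof.
move=> Bn; apply: contrapT => H.
have : (\sum_(p < M.+1) n.+1 <= \sum_(p < M.+1)
    count (fun i => i %% M.+1 == p)%N B)%N.
  apply: leq_sum => p _; rewrite ltnNge; apply/negP => cp.
  by apply: H; exists p.
rewrite sum_nat_const card_ord; apply/negP; rewrite -ltnNge.
apply: leq_ltn_trans Bn.
under eq_bigr do rewrite -sum1_count big_mkcond/=.
rewrite exchange_big/= -[X in (_ <= X)%N]sum1_size; apply: leq_sum => i _.
rewrite -big_mkcond/= (big_pred1 (Ordinal (ltn_pmod i (ltn0Sn M))))//.
Qed.

(** Fewer than (M + 1) (n + 1) indices leave at most n of them to one of the
    M + 1 copies of x in the dilation, and this copy alone retains err x n. *)
Lemma err_dilate M x m n : lq q x -> lq q (dilate M x) ->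
  (m < M.+1 * n.+1)%N -> err q x n <= err q (dilate M x) m.
Proof.
move=> lx ldx mn; have [s gs] := exists_greedy hq ldx; have [sinj _] := gs.
rewrite (err_head_set hq m ldx gs).
have [|p pM pn] := @pigeonhole_residue M n (head_set s m).
  by rewrite card_head_set.
set S := [seq (i %/ M.+1)%N | i <- head_set s m & (i %% M.+1 == p)%N].
pose Bp := [fset k in S]%fset.
have [finj [fc f0]] := residue_part_copy (off Bp x) pM.
apply: (@le_trans _ _ (fine (qsum q (off Bp x)))).
  apply: le_err => //; apply: leq_trans pn.
  rewrite card_imfset//= (leq_trans (size_undup _))// size_map.
  by rewrite size_filter.
rewrite -(qsum_reindex hq finj fc f0).
apply: (le_fine_qsum (lq_off hq _ ldx)).
apply: le_qsum => // k; rewrite /residue_part /off /dilate.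
case: eqP => [kp|_]; last by rewrite normr0.
case: (boolP (k \in head_set s m)) => kB; last by case: ifP; rewrite ?normr0.
rewrite ifT// !inE; apply/mapP; exists k => //.
by rewrite mem_filter kp eqxx.
Qed.

End Copies.

(** * Consequences of the S_q-property *)

Section SqConsequences.
Context {R : realType} (q : R) (hq : 0 < q) (E : set R^nat) (N : R^nat -> R).
Hypothesis hE : quasi_banach_lattice E N.
Hypothesis hS : Sq_property q E N.
Implicit Types (x y : R^nat).

Lemma Sq_sub : E `<=` lq q. Proof. by case: hS. Qed.

(** The S_q-property without equality of the total sums: enlarging y at its
    largest term raises err y 0 to err x 0 and leaves err y m unchanged for m > 0,
    because the greedy sets with m > 0 contain the index of that term. *)
Lemma Sq_majorized : exists C : R, forall x y, E x -> lq q y ->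
  (forall m, err q y m <= err q x m) -> E y /\ N y <= C * N x.
Proof.
have [_ _ [C hC]] := hS; exists C => x y Ex ly eyx.
have lx := Sq_sub Ex; have [s gs] := exists_greedy hq ly; have [sinj _] := gs.
(* In greedy order, s 0 is the index of a largest term of y. *)
pose d := err q x 0 - err q y 0; have d0 : 0 <= d by rewrite subr_ge0.
pose y' : R^nat := fun i =>
  if i == s 0%N then (`|y i| `^ q + d) `^ q^-1 else y i.
have offy (A : {fset nat}) : s 0%N \in A -> off A y' = off A y.
  move=> sA; apply/funext => i; rewrite /off; case: ifPn => // iA.
  by rewrite /y' ifN//; apply: contraNneq iA => ->.
have y's : `|y' (s 0%N)| `^ q = `|y (s 0%N)| `^ q + d.
  rewrite /y' eqxx (ger0_norm (powR_ge0 _ _)) (powRVK hq)//.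
  by rewrite addr_ge0// powR_ge0.
have s0 : s 0%N \in [fset s 0%N]%fset by rewrite inE.
have ly' : lq q y'.
  rewrite /lq /= (qsum_off hq [fset s 0%N]%fset) offy//.
  by rewrite (lq_fin (lq_off hq [fset s 0%N]%fset ly)) -EFinD ltry.
have qy' : fine (qsum q y') = fine (qsum q x).
  rewrite (fine_qsum_off hq [fset s 0%N]%fset ly') offy// big_seq_fset1 y's.
  have := fine_qsum_off hq [fset s 0%N]%fset ly; rewrite big_seq_fset1 => qy.
  by rewrite addrAC -qy /d !err0 addrC subrK.
have ey' m : err q y' m <= err q x m.
  case: m => [|m]; first by rewrite !err0 qy'.
  apply: le_trans (eyx m.+1); rewrite (err_head_set hq m.+1 ly gs).
  rewrite -offy; last by apply/head_setP; exists 0%N.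
  by apply: le_err => //; rewrite card_head_set.
have [Ey' Ny'] : E y' /\ N y' <= C * N x.
  apply: (hC _ _ Ex ly') => [|m]; first by rewrite (lq_fin lx) (lq_fin ly') qy'.
  by have := ey' m; rewrite /err qy' lerD2l lerN2.
have [Ey Ny] : E y /\ N y <= N y'.
  apply: (lat_le hE Ey') => k; rewrite /y'; case: eqP => // _.
  rewrite -[leLHS](powRKV hq (normr_ge0 _)) (ger0_norm (powR_ge0 _ _)).
  by apply: (le_powRV hq); rewrite ?lerDl//; exact: powR_ge0.
by split=> //; exact: le_trans Ny Ny'.
Qed.

(** In particular, E is invariant under injective changes of indices. *)
Lemma Sq_copy : exists C : R, forall f x y, injective f -> copy_of f x y ->
  E x -> E y /\ N y <= C * N x.
Proof.
have [C hC] := Sq_majorized; exists C => f x y finj fxy Ex.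
have lx := Sq_sub Ex.
apply: (hC _ _ Ex) => [|m]; last exact: (copy_err hq m finj fxy lx).
by case: fxy => yf y0; rewrite /lq /= (qsum_reindex hq finj yf y0).
Qed.

Lemma Sq_dilate M : exists C : R, forall x, E x ->
  E (dilate M x) /\ N (dilate M x) <= C * N x.
Proof.
have [C hC] := Sq_copy; have [C1 C11 hC1] := lat_quasi hE.
have C10 : 0 < C1 by exact: lt_le_trans C11.
pose part p (x : R^nat) : R^nat :=
  fun k => if (k %% M.+1 < p)%N then x (k %/ M.+1)%N else 0.
suff H p : (p <= M.+1)%N -> exists D : R, forall x, E x ->
    E (part p x) /\ N (part p x) <= D * N x.
  have [D hD] := H M.+1 (leqnn _); exists D => x /hD.
  suff -> : part M.+1 x = dilate M x by [].
  by apply/funext => k; rewrite /part ltn_mod.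
elim: p => [_|p IH pM].
  exists 0 => x Ex; have -> : part 0%N x = 0 by apply/funext.
  by rewrite (lat_N0 hE) mul0r; split=> //; exact: (lat_E0 hE).
have [D hD] := IH (ltnW pM).
exists (C1 * (D + C)) => x Ex.
have [E1 N1] := hD x Ex.
have [finj fcopy] := residue_part_copy x pM.
have [E2 N2] := hC _ _ _ finj fcopy Ex.
have -> : part p.+1 x = part p x + residue_part M p x.
  apply/funext => k; rewrite seq_addE /part /residue_part ltnS leq_eqVlt.
  by case: eqP => [->|_] /=; rewrite ?ltnn ?add0r// addr0.
split; first exact: (lat_ED hE).
apply: le_trans (hC1 _ _ E1 E2) _.
by rewrite -mulrA ler_pM2l// mulrDl lerD.
Qed.

(** The form in which the S_q-property is used: domination of the errors up to a
    factor in the value and a factor in the number of terms. *)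
Lemma Sq_err_dilation (M : nat) (K : R) : 0 <= K -> exists C : R,
  forall x y, E x -> lq q y ->
    (forall n, err q y (M.+1 * n) <= K `^ q * err q x n) ->
    E y /\ N y <= C * N x.
Proof.
move=> K0; have [C0 hC0] := Sq_majorized; have [D hD] := Sq_dilate M.
have [C [hC C_ge0]] : exists C, (forall x y, E x -> lq q y ->
  (forall m, err q y m <= err q x m) -> E y /\ N y <= C * N x) /\ 0 <= C.
  exists (Num.max C0 0); split; last by rewrite le_max lexx orbT.
  move=> x y Ex ly exy; have [Ey Ny] := hC0 x y Ex ly exy; split=> //.
  apply: le_trans Ny _; apply: ler_wpM2r; first exact: (lat_N_ge0 hE).
  by rewrite le_max lexx.
exists (C * (K * D)) => x y Ex ly H.
have [Ed Nd] := hD x Ex; have lx := Sq_sub Ex; have ld := Sq_sub Ed.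
have Ez := lat_EZ hE K Ed.
have [|Ey Ny] := hC _ _ Ez ly.
  move=> m; apply: le_trans (err_scale hq K m ld).
  apply: (@le_trans _ _ (K `^ q * err q x (m %/ M.+1))).
    apply: le_trans (H _); apply: err_nonincr => //.
    by rewrite mulnC leq_trunc_div.
  rewrite (ger0_norm K0); apply: ler_wpM2l; first exact: powR_ge0.
  by apply: err_dilate => //; rewrite mulnC ltn_ceil.
split=> //; apply: le_trans Ny _; rewrite (lat_NZ hE)// (ger0_norm K0).
by rewrite -!mulrA !ler_wpM2l.
Qed.

(** Some nonzero coordinate of some element puts one unit vector in E, and
    transpositions of indices put all of them there. *)
Lemma Sq_l0 : @l0 R `<=` E.
Proof.
have [En0 _ _] := hS; have [C hC] := Sq_copy.
have [x [Ex x0]] : exists x, E x /\ x <> 0.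
  apply: contrapT => H; apply: En0; apply/seteqP; split=> [x Ex|x ->] /=.
    by apply: contrapT => x0; apply: H; exists x.
  exact: (lat_E0 hE).
have [k xk] : exists k, x k <> 0.
  apply: contrapT => H; apply: x0; apply/funext => k.
  by apply: contrapT => xk; apply: H; exists k.
pose e (j : nat) : R^nat := fun i => if i == j then 1 else 0.
have Eek : E (e k).
  have [] // := lat_le hE (y := e k) (lat_EZ hE ((x k)^-1) Ex).
  move=> i; rewrite seq_scaleE /e; case: eqP => [->|_]; last by rewrite normr0.
  by rewrite mulVf//; exact/eqP.
have Ee j : E (e j).
  pose f i := if i == k then j else if i == j then k else i.
  have fK : involutive f.
    move=> i; rewrite /f; have [->|ik] := eqVneq i k.
      by have [->|jk] := eqVneq j k; rewrite ?eqxx.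
    have [->|ij] := eqVneq i j; first by rewrite eqxx.
    by rewrite (negbTE ik) (negbTE ij).
  have fi := inv_inj fK.
  have [] // := hC f (e k) (e j) fi _ Eek; split=> [i|i ni].
    rewrite /e -[in RHS](inj_eq fi); congr (if _ == _ then _ else _).
    by rewrite /f eqxx.
  by case: (ni (f i)); rewrite fK.
move=> u fu.
suff H (r : seq nat) : E (fun i => if i \in r then u i else 0).
  rewrite (_ : u = fun i => if i \in (fset_set (supp u) : seq nat) then u i else 0)//.
  apply/funext => i; rewrite in_fset_set//; case: ifPn => //.
  by rewrite notin_setE /= => /negP; rewrite negbK => /eqP.
elim: r => [|a r IH]; first exact: (lat_E0 hE).
have [] // := lat_le hE (lat_ED hE IH (lat_EZ hE (u a) (Ee a)))
  (y := fun i => if i \in a :: r then u i else 0).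
move=> i; rewrite seq_addE seq_scaleE /e inE; case: eqP => [->|_] /=; last first.
  by rewrite mulr0 addr0.
rewrite mulr1; case: ifP => _; last by rewrite add0r.
by rewrite -mulr2n normrMn mulr2n lerDl.
Qed.

(** The cardinality functional takes no value strictly between 0 and 1, which
    settles the first inclusion with d = 1. *)
Lemma intermediate_of_sub : @l0 R `<=` E -> E `<=` lq q -> intermediate q E N.
Proof.
move=> l0E Elq; split; split=> // x Ex e e0.
  exists 1 => // y l0y yx; suff -> : y - x = 0 by rewrite (lat_N0 hE).
  have fs : finite_set (supp (y - x)).
    apply: (@sub_finite_set _ _ (supp y `|` supp x)); last by rewrite finite_setU.
    move=> i yxi; change (is_true (y i - x i != 0)) in yxi.
    have [yi|] := eqVneq (y i) 0; last by left.
    by right; apply: contraNneq yxi => xi; rewrite yi xi subrr.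
  move: yx; rewrite /l0norm ltrn1 ltnS leqn0 cardfs_eq0 => /eqP /(fset_set_set0 fs) s0.
  apply/funext => i; apply/eqP/negPn/negP => yxi.
  by have : supp (y - x) i by []; rewrite s0.
have [K K0 hK] := lat_incl hE hq Elq.
exists (e / K) => [|y Ey yx]; first by rewrite divr_gt0.
have Eyx : E (y - x) by apply: (lat_ED hE) => //; rewrite -scaleN1r; exact: (lat_EZ hE).
by apply: le_lt_trans (hK _ Eyx) _; rewrite mulrC -ltr_pdivlMr.
Qed.

Lemma Sq_intermediate : intermediate q E N.
Proof. exact: intermediate_of_sub Sq_l0 Sq_sub. Qed.

Lemma Sq_uniform_K_monotone : uniform_K_monotone q E N.
Proof.
split; first exact: Sq_intermediate.
have [C hC] := Sq_err_dilation 1 (ler0n R 2); exists C => x y Ex ly K.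
by apply: (hC x y Ex ly); exact: err_le_of_Kfun (Sq_sub Ex) ly K.
Qed.

End SqConsequences.

(** * Operators on the couple *)

Section Admissible.
Context {R : realType} (q : R) (hq : 0 < q).
Implicit Types (x y : R^nat).

Lemma lq0 : lq q (0 : R^nat).
Proof.
rewrite /lq /= /qsum (_ : (\sum_(0 <= k <oo) _)%E = 0%E) ?ltry//.
apply: eseries0 => k _ _; rewrite normr0 (powR00 hq)//.
Qed.

Lemma l0norm0 : l0norm (0 : R^nat) = 0.
Proof.
apply/eqP; rewrite eq_le l0norm_ge0 andbT.
by have [_] := @supp_sub_l0 R fset0 0 (fun _ _ => erefl); rewrite cardfs0.
Qed.

Lemma l0norm_gt0 x : l0 x -> x <> 0 -> 0 < l0norm x.
Proof.
move=> l0x x0; rewrite ltr0n cardfs_gt0; apply/negP => /eqP.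
move/(fset_set_set0 l0x) => s0; apply: x0; apply/funext => i.
apply/eqP/negPn/negP => xi.
by have : supp x i by []; rewrite s0.
Qed.

(** T maps the greedy m-term part of x to a sequence with boundedly more terms,
    and the remainder to one of boundedly larger norm. *)
Lemma admissible_err T : admissible_operator q T -> exists (M : nat) (K : R),
  0 <= K /\ forall x, lq q x -> lq q (T x) /\
    forall n, err q (T x) (M.+1 * n) <= K `^ q * err q x n.
Proof.
move=> [Tlin [Tlq [K0 hK0]] Tl0 [B hB]].
pose K := Num.max K0 0.
have Kge0 : 0 <= K by rewrite le_max lexx orbT.
have hK x : lq q x -> lqnorm q (T x) <= K * lqnorm q x.
  move=> lx; apply: le_trans (hK0 x lx) _; apply: ler_wpM2r.
    exact: lqnorm_ge0.
  by rewrite le_max lexx.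
have T0 : T 0 = 0.
  have := Tlin 1 _ _ lq0 lq0; rewrite !scale1r addr0 => T00.
  by apply: (@addrI _ (T 0)); rewrite addr0.
pose M := Num.truncn B.
have hM u : l0 u -> l0norm (T u) <= M.+1%:R * l0norm u.
  move=> lu; have [->|u0] := pselect (u = 0); first by rewrite T0 l0norm0 mulr0.
  rewrite -ler_pdivrMr ?l0norm_gt0//; apply: (@le_trans _ _ B).
    by apply: hB; exists u.
  exact/ltW/truncnS_gt.
exists M, K; split=> // x lx; split=> [|n]; first exact: Tlq.
have [s gs] := exists_greedy hq lx; have [sinj _] := gs.
have lon : lq q (on (head_set s n) x).
  apply: (le_lq hq _ lx) => k; rewrite /on; case: ifP => // _.
  by rewrite normr0.
have loff := lq_off hq (head_set s n) lx.
have TxE : T x = T (on (head_set s n) x) + T (off (head_set s n) x).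
  by have := Tlin 1 _ _ lon loff; rewrite !scale1r -on_off.
apply: le_trans (err_le_split hq (Tlq _ lx) (Tl0 _ (l0_on _ _)) (Tlq _ loff) TxE _) _.
  apply: le_trans (hM _ (l0_on _ _)) _.
  rewrite natrM ler_pM2l ?ltr0n//.
  by apply: le_trans (l0norm_on _ _) _; rewrite card_head_set.
rewrite (err_head_set hq n lx gs).
apply: (le_powRV_scale hq) => //; first exact: fine_qsum_ge0.
  exact: fine_qsum_ge0.
exact: hK.
Qed.

End Admissible.

Section Directions.
Context {R : realType} (q : R) (hq : 0 < q) (E : set R^nat) (N : R^nat -> R).
Hypothesis hE : quasi_banach_lattice E N.

Lemma Sq_Int : Sq_property q E N -> Int_l0_lq q E N.
Proof.
move=> hS; split; [exact: hE.1|exact: Sq_intermediate|] => T hT.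
have [M [K [K0 hMK]]] := admissible_err hq hT.
have [C hC] := Sq_err_dilation hq hE hS M K0.
have main x : E x -> E (T x) /\ N (T x) <= C * N x.
  move=> Ex; have [lTx eTx] := hMK x (Sq_sub hS Ex).
  exact: hC.
split=> [x Ex|]; first exact: (main x Ex).1.
by exists C => x Ex; exact: (main x Ex).2.
Qed.

Lemma l0_neq0 : @l0 R `<=` E -> E <> [set 0].
Proof.
move=> l0E E0.
have : E (on [fset 0%N]%fset (fun=> 1)) by exact/l0E/l0_on.
rewrite E0 => /= /(congr1 (fun f => f 0%N)); rewrite /on inE eqxx.
by move/eqP; rewrite oner_eq0.
Qed.

Lemma uniform_K_monotone_Sq : uniform_K_monotone q E N -> Sq_property q E N.
Proof.
move=> [[[l0E _] [Elq _]] [C hC]]; split=> //; first exact: l0_neq0.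
exists C => x y Ex ly qxy hr; apply: (hC _ _ Ex ly).
apply: (Kfun_le_of_err hq (Elq _ Ex) ly) => m.
by rewrite /err qxy lerD2l lerN2.
Qed.

End Directions.

(** * Matrices with finite rows and sparse columns *)

Section RowOperators.
Context {R : realType} (q : R) (hq : 0 < q).
Implicit Types (x y u : R^nat) (G : nat -> {fset nat}).

Definition row_operator G (c : nat -> nat -> R) u : R^nat :=
  fun k => \sum_(j <- G k) c k j * u j.

(** Each index occurs in at most m of the sets, that is, each column of a matrix
    with row supports G has at most m nonzero entries. *)
Definition overlap_le (m : nat) G : Prop := forall j,
  exists2 S : {fset nat}, (#|` S| <= m)%N & forall k, j \in G k -> k \in S.

Lemma nneseries_fset (A : {fset nat}) (a : nat -> R) : (forall j, 0 <= a j) ->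
  (\sum_(0 <= j <oo) (if j \in A then a j else 0)%:E)%E
  = (\sum_(j <- A) a j)%:E.
Proof.
move=> a0; rewrite nneseries_esumT; last first.
  by move=> j; case: ifP; rewrite lee_fin.
transitivity (\esum_(j in [set` A]) (a j)%:E); last first.
  rewrite esum_fset//; last by move=> j _; rewrite lee_fin.
  by rewrite fsbig_finite ?set_fsetK ?sumEFin//; exact: finite_fset.
rewrite [RHS]esum_mkcond; apply: eq_esum => j _.
rewrite (_ : (j \in [set` A]) = (j \in A)); first by case: ifP.
by apply/idP/idP; rewrite inE.
Qed.

(** After exchanging the two summations, the term of u at j is counted at most m
    times. *)
Lemma row_sum_overlap m G u : overlap_le m G ->
  (\sum_(0 <= k <oo) (\sum_(j <- G k) `|u j| `^ q)%:E <= m%:R%:E * qsum q u)%E.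
Proof.
move=> Gm; pose a k j := (if j \in G k then `|u j| `^ q else 0)%:E.
have a0 k j : (0 <= a k j)%E.
  by rewrite /a lee_fin; case: ifP => // _; exact: powR_ge0.
rewrite (eq_eseriesr (g := fun k => (\sum_(0 <= j <oo) a k j)%E)); last first.
  by move=> k _; rewrite nneseries_fset// => j; exact: powR_ge0.
rewrite (nneseries_interchange _ _ a0) /qsum -nneseriesZl; last first.
  by move=> *; exact: qterm_ge0.
apply: lee_nneseries => [j _ _|j _]; first by apply: nneseries_ge0.
have [S Sm SG] := Gm j.
apply: (@le_trans _ _ (\sum_(0 <= k <oo) (if k \in S then `|u j| `^ q else 0)%:E)%E).
  apply: lee_nneseries => // k _; rewrite lee_fin; case: ifP => [/SG ->//|_].
  by case: ifP => // _; exact: powR_ge0.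
rewrite nneseries_fset => [|k]; last exact: powR_ge0.
rewrite big_const_seq count_predT iter_addr addr0 -EFinM lee_fin -[_ *+ size _]mulr_natl.
by apply: ler_wpM2r; [exact: powR_ge0|rewrite ler_nat].
Qed.

Lemma overlap_fset m G (r : seq nat) : overlap_le m G ->
  exists2 S : {fset nat}, (#|` S| <= m * size r)%N &
    forall j k, j \in r -> j \in G k -> k \in S.
Proof.
move=> Gm; elim: r => [|a r [S Sr SG]].
  by exists fset0; rewrite ?cardfs0// => j k; rewrite in_nil.
have [S' S'm S'G] := Gm a; exists (S' `|` S)%fset.
  by rewrite mulnS (leq_trans (leq_card_fsetU _ _))// leq_add.
move=> j k; rewrite in_fsetU inE => /orP[/eqP ->|jr jk].
  by move=> /S'G ->.
by rewrite (SG j k jr jk) orbT.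
Qed.

(** Few entries per column bound the number of nonzero terms of the image; with a
    row-wise estimate they also bound its l^q-norm. *)
Lemma row_operator_admissible m G c (K : R) : 0 <= K -> overlap_le m G ->
  (forall u k, `|row_operator G c u k| `^ q
     <= K * \sum_(j <- G k) `|u j| `^ q) ->
  admissible_operator q (row_operator G c).
Proof.
move=> K0 Gm hK; set T := row_operator G c.
have qT u : (qsum q (T u) <= (K * m%:R)%:E * qsum q u)%E.
  apply: (@le_trans _ _ (K%:E *
      \sum_(0 <= k <oo) (\sum_(j <- G k) `|u j| `^ q)%:E)%E).
    rewrite -nneseriesZl; last first.
      by move=> k _; rewrite lee_fin sumr_ge0// => j _; exact: powR_ge0.
    apply: lee_nneseries => [k _ _|k _]; first exact: qterm_ge0.
    by rewrite -EFinM lee_fin; exact: hK.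
  by rewrite EFinM -muleA lee_wpmul2l ?lee_fin//; exact: row_sum_overlap.
have lT u : lq q u -> lq q (T u).
  move=> lu; apply: le_lt_trans (qT u) _.
  by rewrite (lq_fin lu) -EFinM ltry.
have l0T u : l0 u -> l0 (T u) /\ l0norm (T u) <= m%:R * l0norm u.
  move=> lu; have [S Sm SG] := overlap_fset (fset_set (supp u)) Gm.
  have TS i : i \notin S -> T u i = 0.
    move=> iS; rewrite /T /row_operator big_seq big1// => j jG.
    have [->|uj] := eqVneq (u j) 0; first by rewrite mulr0.
    move/negP: iS; case; apply: (SG j i) => //.
    by rewrite in_fset_set// inE.
  have [l0Tu TuS] := supp_sub_l0 TS; split=> //.
  by apply: le_trans TuS _; rewrite /l0norm -natrM ler_nat.
split.
- move=> a x y _ _; apply/funext => k.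
  rewrite seq_addE seq_scaleE /T /row_operator mulr_sumr -big_split/=.
  by apply: eq_bigr => j _; rewrite seq_addE seq_scaleE; ring.
- split; first exact: lT.
  exists ((K * m%:R) `^ q^-1) => u lu.
  have Km0 : 0 <= K * m%:R by rewrite mulr_ge0.
  rewrite /lqnorm -(powRM _ Km0 (fine_qsum_ge0 _ _)); apply: (le_powRV hq).
    exact: fine_qsum_ge0.
  by rewrite -lee_fin EFinM -(lq_fin lu) -(lq_fin (lT _ lu)).
- by move=> u /l0T[].
exists m%:R => _ [u [lu u0] <-].
by rewrite ler_pdivrMr ?l0norm_gt0//; case: (l0T u lu).
Qed.

Definition pull (g : nat -> option nat) u : R^nat :=
  fun k => if g k is Some i then u i else 0.

Lemma pull_admissible (g : nat -> option nat) :
  (forall k l i, g k = Some i -> g l = Some i -> k = l) ->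
  admissible_operator q (pull g).
Proof.
move=> ginj.
pose G k : {fset nat} := if g k is Some i then [fset i]%fset else fset0.
have -> : pull g = row_operator G (fun _ _ => 1).
  apply/funext => u; apply/funext => k; rewrite /pull /row_operator /G.
  by case: (g k) => [i|]; rewrite ?big_seq_fset1 ?mul1r ?big_seq_fset0.
have GE j k : j \in G k -> g k = Some j.
  by rewrite /G; case: (g k) => [i|]; rewrite inE // => /eqP ->.
apply: (@row_operator_admissible 1 _ _ 1) => // [j|u k].
  have [[k0 k0j]|nk] := pselect (exists k, j \in G k); last first.
    by exists fset0; rewrite ?cardfs0// => k jk; case: nk; exists k.
  exists [fset k0]%fset; first by rewrite cardfs1.
  by move=> k /GE jk; rewrite inE; apply/eqP/(ginj _ _ j jk)/GE.
rewrite mul1r /row_operator /G; case: (g k) => [i|].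
  by rewrite !big_seq_fset1 mul1r.
by rewrite !big_seq_fset0 normr0 (powR00 hq).
Qed.

(** The data from which a matrix mapping x to y is made: the terms of x in the
    k-th row are large enough together to produce the k-th term of y.  The bound
    three stands for one diagonal entry and two others (see tail_cover). *)
Definition spread x y : Prop := exists2 G, overlap_le 3 G &
  forall k, `|y k| `^ q <= 2 * \sum_(j <- G k) `|x j| `^ q.

(** Jensen's inequality up to the factor 2 ^ q.  For q >= 1 one has
    w <= 1 + w ^ q; apply this to w = v_j / m, where m is the q-th mean of v. *)
Lemma power_mean_le (s : seq nat) (p v : nat -> R) : 1 <= q ->
  (forall j, 0 <= p j) -> (forall j, 0 <= v j) -> \sum_(j <- s) p j <= 1 ->
  (\sum_(j <- s) p j * v j) `^ q <= 2 `^ q * \sum_(j <- s) p j * v j `^ q.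
Proof.
move=> q1 p0 v0 p1; set S := \sum_(j <- s) p j * v j `^ q.
have pv0 j : 0 <= p j * v j `^ q by rewrite mulr_ge0// powR_ge0.
have S0 : 0 <= S by rewrite sumr_ge0.
move: S0; rewrite le_eqVlt => /orP[/eqP S0|S0].
  rewrite -S0 mulr0 big_seq big1 ?(powR00 hq)// => j js.
  have /eqP : p j * v j `^ q = 0.
    apply/eqP; rewrite eq_le pv0 andbT S0 /S.
    by rewrite (big_rem j js)/= lerDl sumr_ge0.
  by rewrite mulf_eq0 powR_eq0 => /orP[/eqP ->|/andP[/eqP -> _]]; rewrite (mul0r, mulr0).
pose m := S `^ q^-1; have m0 : 0 < m by exact: powR_gt0.
have mq : m `^ q = S by rewrite /m (powRVK hq (ltW S0)).
have tang w : 0 <= w -> w <= 1 + w `^ q.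
  move=> w0; have [w1|/ltW w1] := leP w 1.
    by apply: le_trans w1 _; rewrite lerDl powR_ge0.
  by apply: le_trans (le1r_powR w1 q1) _; rewrite lerDr.
have vm j : v j <= m * (1 + v j `^ q / S).
  have vm0 : 0 <= v j / m by exact: divr_ge0 (v0 j) (ltW m0).
  have vmq : v j `^ q / S = (v j / m) `^ q.
    rewrite -{1}(divfK (lt0r_neq0 m0) (v j)) (powRM _ vm0 (ltW m0)) mq.
    by rewrite mulfK// gt_eqF.
  by rewrite vmq mulrC -ler_pdivrMr//; exact: tang.
rewrite -mq -(powRM _ (ler0n R 2) (ltW m0)); apply: (le_powRq hq).
  by rewrite sumr_ge0// => j _; rewrite mulr_ge0.
apply: (@le_trans _ _ (\sum_(j <- s) (m * p j + m * (p j * v j `^ q / S)))).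
  apply: ler_sum => j _; apply: le_trans (ler_wpM2l (p0 j) (vm j)) _.
  by rewrite le_eqVlt; apply/orP; left; apply/eqP; ring.
rewrite big_split/= -!mulr_sumr -mulr_suml -/S mulfV ?gt_eqF// mulr1.
by rewrite mulr_natl mulr2n lerD2r ger_pMr.
Qed.

(** The k-th row sends u to y_k times the average of u_j / x_j over j in G_k with
    weights proportional to |x_j| ^ q.  The average is 1 for u = x, and its q-th
    power is controlled by the average of |u_j / x_j| ^ q, in which the weights
    cancel the denominators. *)
Lemma spread_operator x y : 1 <= q -> spread x y ->
  exists2 T, admissible_operator q T & T x = y.
Proof.
move=> q1 [G G3 Gy].
pose M k := \sum_(j <- G k) `|x j| `^ q.
have M0 k : 0 <= M k by rewrite sumr_ge0// => j _; exact: powR_ge0.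
have yM0 k : M k = 0 -> y k = 0.
  move=> Mk; have := Gy k; rewrite -/(M k) Mk mulr0 => yk.
  apply/normr0_eq0/(@powR_eq0_eq0 _ _ q)/eqP.
  by rewrite eq_le yk powR_ge0.
pose c k j := y k * (`|x j| `^ q / M k / x j).
exists (row_operator G c); last first.
  apply/funext => k; rewrite /row_operator.
  have [Mk|Mk] := eqVneq (M k) 0.
    by rewrite yM0// big1// => j _; rewrite /c yM0// mul0r mul0r.
  rewrite (eq_bigr (fun j => y k * (`|x j| `^ q / M k))); last first.
    move=> j _; rewrite /c -mulrA; congr (_ * _).
    have [->|xj] := eqVneq (x j) 0; first by rewrite normr0 (powR00 hq) !mul0r.
    by rewrite divfK.
  by rewrite -mulr_sumr -mulr_suml -/(M k) mulfV// mulr1.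
apply: (@row_operator_admissible 3 _ _ (2 * 2 `^ q)) => // u k.
have [Mk|Mk] := eqVneq (M k) 0.
  rewrite /row_operator big1 => [|j _]; last by rewrite /c yM0// !mul0r.
  by rewrite normr0 (powR00 hq) mulr_ge0// sumr_ge0// => j _; exact: powR_ge0.
have Mk0 : 0 < M k by rewrite lt_neqAle eq_sym Mk M0.
pose p j := `|x j| `^ q / M k; pose v j := `|u j| / `|x j|.
have p0 j : 0 <= p j by rewrite divr_ge0// powR_ge0.
have v0 j : 0 <= v j by rewrite divr_ge0.
have p1 : \sum_(j <- G k) p j <= 1 by rewrite -mulr_suml -/(M k) mulfV.
have Tle : `|row_operator G c u k| <= `|y k| * \sum_(j <- G k) p j * v j.
  rewrite mulr_sumr; apply: le_trans (ler_norm_sum _ _ _) _.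
  apply: ler_sum => j _; rewrite /c -/(p j) 2!normrM (normrM (p j)) normfV.
  rewrite (ger0_norm (p0 j)).
  by rewrite le_eqVlt; apply/orP; left; apply/eqP; rewrite /v; ring.
have pv0 : 0 <= \sum_(j <- G k) p j * v j.
  by rewrite sumr_ge0// => j _; rewrite mulr_ge0.
apply: le_trans (le_powRq hq (normr_ge0 _) Tle) _.
rewrite (powRM _ (normr_ge0 _) pv0).
apply: (@le_trans _ _ (`|y k| `^ q * (2 `^ q *
    ((\sum_(j <- G k) `|u j| `^ q) / M k)))).
  apply: ler_wpM2l; first exact: powR_ge0.
  apply: le_trans (power_mean_le q1 p0 v0 p1) _.
  apply: ler_wpM2l; first exact: powR_ge0.
  rewrite mulr_suml; apply: ler_sum => j _; rewrite /p /v.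
  have [xj|xj] := eqVneq (x j) 0.
    by rewrite xj normr0 (powR00 hq) !mul0r divr_ge0// powR_ge0.
  rewrite mulrAC ler_pM2r ?invr_gt0//.
  rewrite -(powRM _ (normr_ge0 _) (v0 j)) /v mulrC divfK//.
  by rewrite normr_eq0.
set U := \sum_(j <- G k) `|u j| `^ q.
have U0 : 0 <= U by rewrite sumr_ge0// => j _; exact: powR_ge0.
rewrite mulrCA -[leRHS]mulrA [leRHS]mulrCA; apply: ler_wpM2l.
  exact: powR_ge0.
rewrite mulrA ler_pdivrMr// mulrAC; apply: ler_wpM2r => //.
Qed.

End RowOperators.

(** * Covering the intervals of one tail sequence by those of another *)

Section TailCover.
Context {R : realType}.

Lemma card_seq3 (a b c : nat) : (#|` [fset i in [:: a; b; c]]%fset| <= 3)%N.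
Proof. by rewrite card_imfset//=; exact: size_undup [:: a; b; c]. Qed.

(** Clip the values of A to the interval from s to b.  The clipped differences add
    up to b - s, do not exceed those of A, and vanish unless the interval from
    A (j + 1) to A j meets the one from s to b. *)
Lemma telescope_clip (A : R^nat) (s b : R) (r : nat) :
  (forall j, A j.+1 <= A j) -> s <= b -> b <= A 0%N -> A r <= s ->
  b - s <= \sum_(j <- iota 0 r | (s < A j) && (A j.+1 < b)) (A j - A j.+1).
Proof.
move=> Adec sb bA As; pose clip a := Num.min (Num.max a s) b.
have -> : b - s = \sum_(j <- iota 0 r) (clip (A j) - clip (A j.+1)).
  have -> : iota 0 r = index_iota 0 r by rewrite /index_iota subn0.
  rewrite -[RHS]opprK -sumrN.
  under eq_bigr do rewrite opprB.
  rewrite telescope_sumr// opprB /clip.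
  rewrite (max_idPr As) (min_idPl sb) (max_idPl (le_trans sb bA)).
  by rewrite (min_idPr bA).
rewrite [leRHS]big_mkcond/=; apply: ler_sum => j _.
have aa' := Adec j; rewrite /clip.
have [sa|/=] := boolP (s < A j); last first.
  rewrite -leNgt => as_.
  by rewrite (max_idPr as_) (max_idPr (le_trans aa' as_)) subrr.
have [a'b|/=] := boolP (A j.+1 < b); last first.
  rewrite -leNgt => ba'; have ba := le_trans ba' aa'.
  rewrite (max_idPl (ltW sa)) (max_idPl (le_trans sb ba')).
  by rewrite (min_idPr ba) (min_idPr ba') subrr.
apply: lerB; first by rewrite (max_idPl (ltW sa)) ge_min lexx.
by rewrite le_min (ltW a'b) andbT le_max lexx.
Qed.

(** The intervals from A (j + 1) to A j and from B (i + 1) to B i lie on the same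
    half-line.  If the i-th interval of B is no longer than that of A, the latter
    is taken alone.  Otherwise take those intervals of A which meet the upper
    half of the i-th interval of B; staying away from its lower end keeps their
    number finite.  An interval of A that meets two of these halves covers the
    intervals of B between them, but as B <= A it comes later than each of them
    and is shorter, so there is none between. *)
Lemma tail_cover (A B : R^nat) :
  (forall j, A j.+1 <= A j) -> (forall i, B i.+1 <= B i) ->
  (forall i, 0 <= B i) -> (forall i, B i <= A i) ->
  (forall i j, (i <= j)%N -> A j - A j.+1 <= A i - A i.+1) ->
  (forall e, 0 < e -> exists r, A r < e) ->
  exists2 F : nat -> {fset nat}, overlap_le 3 F &
    forall i, B i - B i.+1 <= 2 * \sum_(j <- F i) (A j - A j.+1).
Proof.
move=> Adec Bdec B0 BA Aconv Alim.
have Amono i j : (i <= j)%N -> A j <= A i.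
  by move=> ij; elim: j ij => [|j IH]; [rewrite leqn0 => /eqP ->|
    rewrite leq_eqVlt => /orP[/eqP ->//|/IH]; exact: le_trans].
have Bmono i j : (i <= j)%N -> B j <= B i.
  by move=> ij; elim: j ij => [|j IH]; [rewrite leqn0 => /eqP ->|
    rewrite leq_eqVlt => /orP[/eqP ->//|/IH]; exact: le_trans].
pose big i := A i - A i.+1 < B i - B i.+1.
pose mid i := (B i + B i.+1) / 2.
have /choice[F FP] : forall i, exists F : {fset nat},
    B i - B i.+1 <= 2 * \sum_(j <- F) (A j - A j.+1) /\
    forall j, j \in F -> if big i then mid i < A j /\ A j.+1 < B i else j = i.
  move=> i; have [bi|] := boolP (big i); last first.
    rewrite /big -leNgt => small; exists [fset i]%fset.
    split=> [|j]; last by rewrite inE => /eqP.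
    by rewrite big_seq_fset1; have := Adec i; lra.
  have Bi : B i.+1 < B i by move: bi; rewrite /big; have := Adec i; lra.
  have [|r Ar] := Alim (mid i); first by have := B0 i.+1; rewrite /mid; lra.
  exists [fset j in [seq j <- iota 0 r | (mid i < A j) && (A j.+1 < B i)]]%fset.
  split=> [|j]; last by rewrite !inE mem_filter => /andP[/andP[]].
  rewrite big_imfset//= undup_id ?filter_uniq ?iota_uniq// big_filter.
  have mB : mid i <= B i by rewrite /mid; lra.
  have := telescope_clip Adec mB (le_trans (Bmono _ _ (leq0n i)) (BA 0%N)) (ltW Ar).
  by rewrite /mid; lra.
exists F => [j|i]; last exact: (FP i).1.
have big_le i : big i -> j \in F i -> (i <= j)%N.
  move=> bi /((FP i).2 j); rewrite bi => -[_ ji]; rewrite -ltnS ltnNge.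
  apply/negP => /Amono; rewrite leNgt; move/negP; apply.
  exact: lt_le_trans ji (BA i).
(* The j-th interval of A would cover the i-th one of B and yet be shorter. *)
have between a i b : big a -> big i -> big b -> j \in F a -> j \in F i ->
    j \in F b -> (a < i)%N -> (i < b)%N -> False.
  move=> ba bi bb ja ji jb ai ib; have ij := big_le i bi ji.
  have := (FP a).2 _ ja; rewrite ba => -[ma _].
  have := (FP b).2 _ jb; rewrite bb => -[_ mb].
  have := Bmono _ _ ai; have := Bmono _ _ ib; have := Aconv _ _ ij.
  have := Bdec a; move: bi ma; rewrite /big /mid; lra.
have [[i0 [b0 j0]]|none] := pselect (exists i, big i /\ j \in F i); last first.
  exists [fset j]%fset; first by rewrite cardfs1.
  move=> i ji; have := (FP i).2 _ ji; case: ifPn => [bi|_ ->].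
    by case: none; exists i.
  by rewrite inE.
pose Q i := big i && (j \in F i).
have exQ : exists i, Q i by exists i0; rewrite /Q b0.
have ubQ i : Q i -> (i <= j)%N by move=> /andP[]; exact: big_le.
have [a /andP[ba ja] amin] := ex_minnP exQ.
have [b /andP[bb jb] bmax] := ex_maxnP exQ ubQ.
exists [fset i in [:: j; a; b]]%fset; first exact: card_seq3.
move=> i ji; rewrite !inE; have := (FP i).2 _ ji.
case: ifPn => [bi _|_ ->]; last by rewrite eqxx.
have Qi : Q i by rewrite /Q bi.
have := amin _ Qi; rewrite leq_eqVlt => /orP[/eqP ->|ai].
  by rewrite eqxx orbT.
have := bmax _ Qi; rewrite leq_eqVlt => /orP[/eqP ->|ib].
  by rewrite eqxx !orbT.
by case: (between a i b).
Qed.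

End TailCover.

(** * Matrices from domination of errors *)

Section Spread.
Context {R : realType} (q : R) (hq : 0 < q).
Implicit Types (x y u : R^nat).

(** tail_cover applied to the error sequences, whose differences are the q-th
    powers of the terms in greedy order. *)
Lemma spread_of_err x y : lq q x -> lq q y ->
  (forall m, err q y m <= err q x m) -> spread q x y.
Proof.
move=> lx ly eyx.
have [s gs] := exists_greedy hq lx; have [sinj _] := gs.
have [t gt] := exists_greedy hq ly; have [tinj _] := gt.
have rx j : err q x j - err q x j.+1 = `|x (s j)| `^ q.
  by rewrite errS (rearrE gs).
have ry j : err q y j - err q y j.+1 = `|y (t j)| `^ q.
  by rewrite errS (rearrE gt).
have [||i||i j ij|e e0|F F3 hF] := tail_cover (A := err q x) (B := err q y).
- by move=> j; exact: err_nonincr lx (leqnSn j).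
- by move=> j; exact: err_nonincr ly (leqnSn j).
- exact: (err_ge0 hq).
- exact: eyx.
- rewrite !rx; apply: (le_powRq hq) => //.
  exact: (greedy_nonincr gs).
- exact: (err_small hq lx).
have /choice[G GP] : forall k, exists A : {fset nat},
    (forall i, t i = k -> A = (s @` F i)%fset) /\
    ((forall i, t i <> k) -> A = fset0).
  move=> k; have [[i ik]|nk] := pselect (exists i, t i = k).
    exists (s @` F i)%fset; split=> [l|/(_ i)//].
    by rewrite -ik => /tinj ->.
  by exists fset0; split=> // i ik; case: nk; exists i.
exists G => [j|k].
  have [[j' jE]|nj] := pselect (exists j', s j' = j).
    have [S S3 SF] := F3 j'; exists (t @` S)%fset.
      by rewrite card_imfset.
    move=> k; have [[i ik]|nk] := pselect (exists i, t i = k); last first.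
      by rewrite (GP k).2 ?in_fset0// => i ik; apply: nk; exists i.
    rewrite ((GP k).1 _ ik) -jE mem_imfset//= => /SF iS.
    by rewrite -ik; apply/imfsetP; exists i.
  exists fset0 => [|k]; first by rewrite cardfs0.
  have [[i ik]|nk] := pselect (exists i, t i = k); last first.
    by rewrite (GP k).2 ?in_fset0// => i ik; apply: nk; exists i.
  rewrite ((GP k).1 _ ik) => /imfsetP[j' /= _ jE].
  by case: nj; exists j'.
have [[i ik]|nk] := pselect (exists i, t i = k); last first.
  rewrite (greedy_support hq ly gt) => [|i ik]; last by apply: nk; exists i.
  rewrite normr0 (powR00 hq) mulr_ge0// sumr_ge0// => j _; exact: powR_ge0.
rewrite ((GP k).1 _ ik) -ik -ry big_imfset/=; last by move=> a b _ _; exact: sinj.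
apply: le_trans (hF i) _; rewrite le_eqVlt; apply/orP; left; apply/eqP.
by congr (_ * _); apply: eq_bigr => j _; rewrite rx.
Qed.

Lemma spread_scale (c : R) x y : spread q x y -> spread q (c *: x) (c *: y).
Proof.
move=> [G G3 hG]; exists G => // k; rewrite seq_scaleE normrM.
rewrite (powRM _ (normr_ge0 _) (normr_ge0 _)).
rewrite (eq_bigr (fun j => `|c| `^ q * `|x j| `^ q)) => [|j _].
  by rewrite -mulr_sumr mulrCA; apply: ler_wpM2l => //; exact: powR_ge0.
by rewrite seq_scaleE normrM (powRM _ (normr_ge0 _) (normr_ge0 _)).
Qed.

Lemma spread0 y : spread q 0 y -> y = 0.
Proof.
move=> [G _ hG]; apply/funext => k; have := hG k.
rewrite big1 ?mulr0 => [yk|j _]; last by rewrite normr0 (powR00 hq).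
apply/normr0_eq0/(@powR_eq0_eq0 _ _ q)/eqP.
by rewrite eq_le yk powR_ge0.
Qed.

Definition code (b i : nat) : nat := choice.pickle (b, i).
Definition decode (k : nat) : option (nat * nat) := pickle_inv k.

Lemma codeK b i : decode (code b i) = Some (b, i).
Proof. exact: pickleK_inv. Qed.

Lemma decodeK k b i : decode k = Some (b, i) -> code b i = k.
Proof.
by move=> kE; have := @pickle_invK (nat * nat)%type k; rewrite /oapp -/(decode k) kE.
Qed.

Lemma code_inj b : injective (code b).
Proof. by move=> i j /(congr1 decode); rewrite !codeK => -[]. Qed.

(** The sequences x b placed on disjoint blocks of indices, the b-th block being
    the range of code b. *)
Definition join (x : nat -> R^nat) : R^nat :=
  fun k => if decode k is Some (b, i) then x b i else 0.

Definition block (b : nat) : R^nat -> R^nat := pull (fun i => Some (code b i)).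

Definition unblock (b : nat) : R^nat -> R^nat :=
  pull (fun k => if decode k is Some (b', i) then
                   if b' == b then Some i else None
                 else None).

Lemma block_admissible b : admissible_operator q (block b).
Proof.
by apply: (pull_admissible hq) => k l i [<-] [/code_inj ->].
Qed.

Lemma unblock_admissible b : admissible_operator q (unblock b).
Proof.
apply: (pull_admissible hq) => k l i.
case kE: (decode k) => [[b1 i1]|//]; case: eqP => // b1b [i1i].
case lE: (decode l) => [[b2 i2]|//]; case: eqP => // b2b [i2i].
by rewrite -(decodeK kE) -(decodeK lE) b1b b2b i1i i2i.
Qed.

Lemma block_join b (x : nat -> R^nat) : block b (join x) = x b.
Proof. by apply/funext => i; rewrite /block /pull /join codeK. Qed.

Lemma unblock_join b i k (x : nat -> R^nat) : decode k = Some (b, i) ->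
  unblock b (x b) k = join x k.
Proof. by move=> kE; rewrite /unblock /pull /join kE eqxx. Qed.

Lemma spread_join (x y : nat -> R^nat) :
  (forall b, spread q (x b) (y b)) -> spread q (join x) (join y).
Proof.
move=> xy; have /choice[G GP] : forall b, exists G, overlap_le 3 G /\
    forall k, `|y b k| `^ q <= 2 * \sum_(j <- G k) `|x b j| `^ q.
  by move=> b; have [G] := xy b; exists G.
exists (fun k => if decode k is Some (b, i) then (code b @` G b i)%fset
                 else fset0).
  move=> j; case jE: (decode j) => [[b j']|]; last first.
    exists fset0 => [|k]; first by rewrite cardfs0.
    case: (decode k) => [[b i]|//] /imfsetP[l _ jl].
    by move: jE; rewrite jl codeK.
  have [S S3 SG] := (GP b).1 j'; exists (code b @` S)%fset.
    by rewrite card_imfset//; exact: code_inj.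
  move=> k; case kE: (decode k) => [[b2 i]|]; last by rewrite in_fset0.
  move=> /imfsetP[l /= lG jl]; move: jE; rewrite jl codeK => -[b2b lj].
  rewrite -b2b -(decodeK kE); apply/imfsetP; exists i => //=.
  by rewrite b2b lj in lG *; exact: SG.
move=> k; rewrite {1}/join; case: (decode k) => [[b i]|]; last first.
  by rewrite normr0 (powR00 hq) big_seq_fset0 mulr0.
rewrite big_imfset/=; last by move=> a c _ _; exact: code_inj.
apply: le_trans ((GP b).2 i) _; rewrite le_eqVlt; apply/orP; left; apply/eqP.
by congr (_ * _); apply: eq_bigr => j _; rewrite /join codeK.
Qed.

End Spread.

(** * Uniformity of the constant for interpolation spaces *)

Section Interpolation.
Context {R : realType} (q : R) (hq : 0 < q) (E : set R^nat) (N : R^nat -> R).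
Hypothesis hE : quasi_banach_lattice E N.
Hypothesis q1 : 1 <= q.
Hypothesis hI : Int_l0_lq q E N.
Implicit Types (x y : R^nat).

(** A positive bound, so that it can be divided by. *)
Lemma Int_bounded T : admissible_operator q T ->
  exists2 C : R, 0 < C & forall x, E x -> E (T x) /\ N (T x) <= C * N x.
Proof.
have [_ _ hT] := hI => /hT[TE [C hC]]; exists (Num.max C 1).
  by rewrite lt_max ltr01 orbT.
move=> x Ex; split; first exact: TE.
apply: le_trans (hC x Ex) _; apply: ler_wpM2r; first exact: (lat_N_ge0 hE).
by rewrite le_max lexx.
Qed.

Lemma Int_spread x y : spread q x y -> E x -> E y.
Proof.
move=> /(spread_operator hq q1)[T hT <-] Ex.
by have [C _ hC] := Int_bounded hT; exact: (hC x Ex).1.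
Qed.

(** The gliding hump.  For each b take a pair (x_b, y_b) that violates the
    constant r b, scaled by l b so that x_b moved to the b-th block has norm at
    most c b.  Then the joined sequence of the x_b has a majorant in E, so the
    joined sequence of the y_b is in E; but its b-th block, moved back, has norm
    at least (b + 1) B b, where B b bounds the operator that moves it back.  The
    operators that move blocks are admissible, but B and U need not be bounded
    in b, so r b has to compensate for them. *)
Lemma Int_spread_bounded : exists C : R, forall x y, E x -> spread q x y ->
  N y <= C * N x.
Proof.
apply: contrapT => unbounded.
have large (r : R) : exists x y, [/\ E x, spread q x y & r * N x < N y].
  apply: contrapT => nr; apply: unbounded; exists r => x y Ex xy.
  by rewrite leNgt; apply/negP => lt_r; apply: nr; exists x, y.
have [c [c0 cP]] := lat_sup hE.
have /choice[U UP] : forall b, exists C : R,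
    0 < C /\ forall x, E x -> E (unblock b x) /\ N (unblock b x) <= C * N x.
  by move=> b; have [C C0 hC] := Int_bounded (unblock_admissible hq b); exists C.
have /choice[B BP] : forall b, exists C : R,
    0 < C /\ forall x, E x -> E (block b x) /\ N (block b x) <= C * N x.
  by move=> b; have [C C0 hC] := Int_bounded (block_admissible hq b); exists C.
pose r b := b.+1%:R * B b * U b / c b.
have /choice[xy xyP] : forall b, exists xy : R^nat * R^nat,
    [/\ E xy.1, spread q xy.1 xy.2 & r b * N xy.1 < N xy.2].
  by move=> b; have [x [y xyP]] := large (r b); exists (x, y).
pose x b := (xy b).1; pose y b := (xy b).2.
have Ex b : E (x b) by case: (xyP b).
have Nx b : 0 < N (x b).
  rewrite lt_neqAle (lat_N_ge0 hE (Ex b)) andbT eq_sym; apply/eqP => Nx0.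
  have [_ sxy] := xyP b; rewrite -/(x b) -/(y b) Nx0 mulr0.
  have x0 := lat_N_eq0 hE (Ex b) Nx0.
  move: sxy; rewrite -/(x b) -/(y b) x0 => /(spread0 hq) ->.
  by rewrite (lat_N0 hE) ltxx.
pose l b := c b / (U b * N (x b)).
have l0 b : 0 < l b by rewrite divr_gt0// mulr_gt0//; case: (UP b).
pose x' b := l b *: x b; pose y' b := l b *: y b.
have Ex' b : E (x' b) by exact: (lat_EZ hE).
have [b|X EX XP] := cP (fun b => unblock b (x' b)).
  have [U0 hU] := UP b; have [EU NU] := hU _ (Ex' b); split=> //.
  apply: le_trans NU _; rewrite (lat_NZ hE)// (ger0_norm (ltW (l0 b))).
  rewrite le_eqVlt; apply/orP; left; apply/eqP; rewrite /l.
  by field; rewrite !gt_eqF.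
have EX' : E (join x').
  have [] // := lat_le hE (y := join x') EX => k.
  case kE: (decode k) => [[b i]|]; last by rewrite /join kE normr0.
  by rewrite -(unblock_join x' kE).
have EY' : E (join y').
  apply: Int_spread EX'; apply: (spread_join hq) => b.
  by apply: spread_scale; case: (xyP b).
have big b : b.+1%:R <= N (join y').
  have [B0 hB] := BP b; have [U0 _] := UP b.
  have [EB NB] := hB _ EY'; rewrite block_join in EB NB.
  rewrite -(ler_pM2l B0); apply: le_trans NB.
  have Ey : E (y b) by case: (xyP b) => _ sxy _; exact: Int_spread sxy (Ex b).
  rewrite (lat_NZ hE)// (ger0_norm (ltW (l0 b))).
  have [_ _ /ltW] := xyP b; rewrite -/(x b) -/(y b) => ry.
  apply: le_trans (ler_wpM2l (ltW (l0 b)) ry).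
  rewrite le_eqVlt; apply/orP; left; apply/eqP; rewrite /l /r.
  by field; rewrite !gt_eqF.
have := big (Num.truncn (N (join y'))); apply/negP; rewrite -ltNge.
exact: truncnS_gt.
Qed.

Lemma Int_Sq : Sq_property q E N.
Proof.
have [_ [[l0E _] [Elq _]] _] := hI; split=> //; first exact: l0_neq0 l0E.
have [C hC] := Int_spread_bounded; exists C => x y Ex ly qxy hr.
have xy : spread q x y.
  apply: (spread_of_err hq (Elq _ Ex) ly) => m.
  by rewrite /err qxy lerD2l lerN2.
by split; [exact: Int_spread xy Ex|exact: hC].
Qed.

End Interpolation.

Unset Implicit Arguments.

Theorem theorem6p2 (R : realType) (q : R) (E : set R^nat) (N : R^nat -> R)
    (hq : 0 < q) (hE : quasi_banach_lattice E N) :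
  [/\ Sq_property q E N <-> uniform_K_monotone q E N,
      Sq_property q E N -> Int_l0_lq q E N &
      1 <= q -> (Sq_property q E N <-> Int_l0_lq q E N)].
Proof.
split; last 2 first.
- exact: Sq_Int.
- move=> q1; split; first exact: Sq_Int.
  exact: Int_Sq.
split; first exact: Sq_uniform_K_monotone.
exact: uniform_K_monotone_Sq.
Qed.
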